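(* Assume that there is $\alpha\in(0,1)$ such that $\rho=\rho(\epsilon)$ is defined in the asymptotic range $\epsilon^{\frac{2}{1+\alpha}}\ll\rho\leq\epsilon$, and let ${\bf a}_0\in\ell^2(\mathbb{Z})$ be fixed independently of $\epsilon$. For every $A\in(0,k_0^{-1}\alpha)$, where $k_0$ is the constant defined in the context, there is a small $\epsilon_0>0$ and positive constants $C_0$ and $C$ (independent of $\epsilon$) such that for every $\epsilon\in(0,\epsilon_0)$ for which the initial data satisfies $$\|\xi(0)-{\bf X}(0)\|_{\ell^2}+\|\dot{\xi}(0)-\dot{\bf X}(0)\|_{\ell^2}\leq C_0\,\rho^{-1}\epsilon^2,$$ the solution $\xi(t)$ of the discrete Klein--Gordon equation $$\ddot{\xi}_j+\xi_j+\rho\,\xi_j^3=\epsilon(\xi_{j+1}+\xi_{j-1}),\qquad j\in\mathbb{Z},$$ satisfies, for every $t\in[-A|\log(\rho)|\rho^{-1},\,A|\log(\rho)|\rho^{-1}]$, $$\|\xi(t)-{\bf X}(t)\|_{\ell^2}+\|\dot{\xi}(t)-\dot{\bf X}(t)\|_{\ell^2}\leq C\,\rho^{-1-\alpha}\epsilon^2.$$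
   Context: Here $\xi(t)=\{\xi_j(t)\}_{j\in\mathbb{Z}}$ is real-valued with $\xi(t),\dot\xi(t)\in\ell^2(\mathbb{Z})$, and dots on $\xi$ and ${\bf X}$ denote $d/dt$. The notation $\epsilon^{2/(1+\alpha)}\ll\rho\le\epsilon$ means that $\rho=\rho(\epsilon)>0$ satisfies $\rho\leq\epsilon$ and $\epsilon^{2/(1+\alpha)}/\rho\to0$ as $\epsilon\to0^+$. Set $\nu=\rho/\epsilon$ and let ${\bf a}(\tau)=\{a_j(\tau)\}_{j\in\mathbb{Z}}$, $a_j(\tau)\in\mathbb{C}$, be the global solution in $\ell^2(\mathbb{Z})$ of the discrete nonlinear Schr\''odinger equation $$2i\dot a_j+3\nu|a_j|^2a_j=a_{j+1}+a_{j-1},\qquad j\in\mathbb{Z},$$ with ${\bf a}(0)={\bf a}_0$, where the dot on $a_j$ is the derivative in the slow time $\tau=\epsilon t$. The leading-order approximation ${\bf X}(t)=\{X_j(t)\}_{j\in\mathbb{Z}}$ is $$X_j(t)=a_j(\epsilon t)e^{it}+\bar a_j(\epsilon t)e^{-it}+\tfrac18\rho\left(a_j^3(\epsilon t)e^{3it}+\bar a_j^3(\epsilon t)e^{-3it}\right).$$ The constant $k_0$: let $C_X>0$ be an $\epsilon$-independent constant (depending on $\|{\bf a}_0\|_{\ell^2}$) such that $\|{\bf X}(t)\|_{\ell^2}+\|\dot{\bf X}(t)\|_{\ell^2}\leq C_X$ for all $t\in\mathbb{R}$ and all $\epsilon\in(0,1]$. Then $k_0>0$ is an $\epsilon$-independent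 constant such that, for any $\epsilon$-independent constant $C_Q>0$, the inequality $$6C_X^2+12C_XC_Q\,\rho^{-1-\alpha}\epsilon^2+8C_Q^2\,\rho^{-2(1+\alpha)}\epsilon^4\leq k_0$$ holds for all sufficiently small $\epsilon>0$ (with a threshold that may depend on $C_Q$). *)

(* Defs.v *)
From Stdlib Require Import Reals ZArith.
From Coquelicot Require Export Coquelicot.

Open Scope R_scope.

(** Sums over [Z], used for nonnegative terms only, so that the order of
    summation is irrelevant. *)

Definition ex_Zseries (u : Z -> R) : Prop :=
  ex_series (fun n : nat => u (Z.of_nat n)) /\
  ex_series (fun n : nat => u (- Z.of_nat (S n))%Z).

Definition Zseries (u : Z -> R) : R :=
  Series (fun n : nat => u (Z.of_nat n)) +
  Series (fun n : nat => u (- Z.of_nat (S n))%Z).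

(** The space l^2(Z), for scalars in a real normed module: [R] for the
    oscillator variables, [C_R_NormedModule] (the complex numbers as a real
    normed space) for the amplitudes. *)

Definition in_l2 {V : NormedModule R_AbsRing} (x : Z -> V) : Prop :=
  ex_Zseries (fun j => norm (x j) ^ 2).

(** Only meaningful for sequences satisfying [in_l2]. *)
Definition l2norm {V : NormedModule R_AbsRing} (x : Z -> V) : R :=
  sqrt (Zseries (fun j => norm (x j) ^ 2)).

Lemma norm_C_R (z : C) : @norm R_AbsRing C_R_NormedModule z = Cmod z.
Proof.
  destruct z as [x y].
  change (sqrt (Rabs x ^ 2 + Rabs y ^ 2) = sqrt (x ^ 2 + y ^ 2)).
  now rewrite !pow2_abs.
Qed.

(** Derivative of a curve in l^2(Z) for the l^2 norm (not just componentwise);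
    to be used for curves with values in l^2(Z). *)
Definition is_derive_l2 {V : NormedModule R_AbsRing}
    (x : R -> Z -> V) (t : R) (v : Z -> V) : Prop :=
  in_l2 v /\
  is_lim (fun h => l2norm (fun j =>
            minus (scal (/ h) (minus (x (t + h) j) (x t j))) (v j))) 0 0.

(** Componentwise time derivative, total thanks to [Derive]; it is the l^2
    derivative whenever the latter exists. *)
Definition dot (x : R -> Z -> R) (t : R) (j : Z) : R :=
  Derive (fun s => x s j) t.

(** Global solutions in l^2(Z) of the discrete nonlinear Schroedinger equation
      2 i a_j' + 3 nu |a_j|^2 a_j = a_{j+1} + a_{j-1}. *)
Definition dNLS_solution (nu : R) (a : R -> Z -> C) : Prop :=
  forall tau : R,
    @in_l2 C_R_NormedModule (a tau) /\
    exists da : Z -> C,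
      @is_derive_l2 C_R_NormedModule a tau da /\
      forall j : Z,
        (2 * Ci * da j + RtoC (3 * nu * Cmod (a tau j) ^ 2)%R * a tau j
         = a tau (j + 1)%Z + a tau (j - 1)%Z)%C.

(** Global solutions, twice differentiable in l^2(Z), of the discrete
    Klein-Gordon equation
      xi_j'' + xi_j + rho xi_j^3 = eps (xi_{j+1} + xi_{j-1}). *)
Definition dKG_solution (rho eps : R) (xi : R -> Z -> R) : Prop :=
  forall t : R,
    in_l2 (xi t) /\
    is_derive_l2 xi t (dot xi t) /\
    is_derive_l2 (dot xi) t (dot (dot xi) t) /\
    forall j : Z,
      dot (dot xi) t j + xi t j + rho * xi t j ^ 3
      = eps * (xi t (j + 1)%Z + xi t (j - 1)%Z).

(** [cis theta] is exp(i theta). *)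
Definition cis (theta : R) : C := (cos theta, sin theta).

Definition leading_orderC (rho eps : R) (a : R -> Z -> C) (t : R) (j : Z) : C :=
  let z := a (eps * t)%R j in
  (z * cis t + Cconj z * cis (- t)
   + RtoC (1 / 8 * rho)%R
     * (z ^ 3 * cis (3 * t)%R + Cconj z ^ 3 * cis (- (3 * t))%R))%C.

Lemma leading_orderC_real (rho eps : R) (a : R -> Z -> C) (t : R) (j : Z) :
  Im (leading_orderC rho eps a t j) = 0.
Proof.
  unfold leading_orderC, cis.
  destruct (a (eps * t) j) as [x y].
  rewrite !cos_neg, !sin_neg.
  simpl.
  ring.
Qed.

(** The approximation X_j(t), a real number by [leading_orderC_real]. *)
Definition leading_order (rho eps : R) (a : R -> Z -> C) (t : R) (j : Z) : R :=
  Re (leading_orderC rho eps a t j).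

(** ||x(t)-y(t)|| + ||x'(t)-y'(t)||, in l^2(Z) norms. *)
Definition l2_dist1 (x y : R -> Z -> R) (t : R) : R :=
  l2norm (fun j => x t j - y t j) + l2norm (fun j => dot x t j - dot y t j).

(* Main.v *)
Require Import Defs.
From Stdlib Require Import Reals ZArith Lra Lia FunctionalExtensionality.
From Coquelicot Require Import Coquelicot.

Open Scope R_scope.

(** Write [b(t) = a(eps t) exp(it) = u + iw]. By gauge invariance [(u, w)] solves
    an autonomous polynomial system in l^2(Z), and
    [X = 2 u + (rho / 4) Re (b^3)] is polynomial in [(u, w)]; the choice of the
    dNLS equation and of the third harmonic makes the residual of X in the
    Klein-Gordon equation [eps^2] times a polynomial expression in [(u, w)],
    which is bounded uniformly in [eps] and [t] because the l^2 norm of [a] is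
    conserved. For the error [y = xi - X], the quadratic energy
    [(|y'|^2 + |y|^2) / 2 - eps sum_j y_j y_(j+1)] absorbs the linear coupling
    and, as long as [|y| <= C_X], grows at rate at most [12 C_X^2 rho <= 2 k0 rho],
    up to a forcing [O(eps^4 / rho)]. Gronwall's inequality on the time scale
    [A |ln rho| / rho] costs a factor [rho^(-2 alpha)] for the energy, and the
    resulting bound, being [o(1)], closes the bootstrap. *)

(** The energy argument differentiates X twice in l^2(Z), while the amplitude equation grants [a] a
    single derivative. In the frame [(u, w)] this is no obstacle: the right-hand side of the system
    is polynomial with no explicit time dependence, so it can be differentiated along itself, and
    the derivatives of X become explicit expressions in [(u, w)]. Since l^2(Z) is an algebra, a
    bound on [(u, w)] passes to any such expression, and no constant of the residual has to be
    computed.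

    The rate [12 * C_X ^ 2 * rho] leaves room above what the linearised coefficient [3 * X ^ 2]
    requires. This room lets the bootstrap run at the fixed level [|y| <= C_X] instead of a level
    shrinking with [eps]: there [|3 X^2 + 3 X y + y^2| <= 7 C_X^2], which the rate still covers
    together with the share of the forcing that is moved into the energy. *)

(** * Series indexed by the integers *)

Lemma ex_Zseries_plus (u v : Z -> R) :
  ex_Zseries u -> ex_Zseries v -> ex_Zseries (fun j => u j + v j).
Proof.
  intros [Hu1 Hu2] [Hv1 Hv2]; split.
  - exact (ex_series_plus _ _ Hu1 Hv1).
  - exact (ex_series_plus _ _ Hu2 Hv2).
Qed.

Lemma ex_Zseries_scal (c : R) (u : Z -> R) :
  ex_Zseries u -> ex_Zseries (fun j => c * u j).
Proof.
  intros [Hu1 Hu2]; split.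
  - exact (ex_series_scal_l c _ Hu1).
  - exact (ex_series_scal_l c _ Hu2).
Qed.

Lemma ex_Zseries_le (u v : Z -> R) :
  (forall j, Rabs (u j) <= v j) -> ex_Zseries v -> ex_Zseries u.
Proof.
  intros H [Hv1 Hv2]; split.
  - exact (@ex_series_le R_AbsRing R_CompleteNormedModule _ _
             (fun n => H (Z.of_nat n)) Hv1).
  - exact (@ex_series_le R_AbsRing R_CompleteNormedModule _ _
             (fun n => H (- Z.of_nat (S n))%Z) Hv2).
Qed.

Lemma Zseries_plus (u v : Z -> R) :
  ex_Zseries u -> ex_Zseries v ->
  Zseries (fun j => u j + v j) = Zseries u + Zseries v.
Proof.
  intros [Hu1 Hu2] [Hv1 Hv2]; unfold Zseries.
  rewrite (Series_plus _ _ Hu1 Hv1), (Series_plus _ _ Hu2 Hv2); ring.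
Qed.

Lemma Zseries_scal (c : R) (u : Z -> R) :
  Zseries (fun j => c * u j) = c * Zseries u.
Proof. unfold Zseries; rewrite !Series_scal_l; ring. Qed.

Lemma Zseries_le (u v : Z -> R) :
  (forall j, 0 <= u j <= v j) -> ex_Zseries v -> Zseries u <= Zseries v.
Proof.
  intros H [Hv1 Hv2]; unfold Zseries.
  apply Rplus_le_compat; apply Series_le; auto.
Qed.

Lemma Zseries_ge0 (u : Z -> R) :
  (forall j, 0 <= u j) -> ex_Zseries u -> 0 <= Zseries u.
Proof.
  intros H Hu.
  replace 0 with (Zseries (fun j => 0 * u j)) by (rewrite Zseries_scal; ring).
  apply Zseries_le; trivial.
  intros j; specialize (H j); lra.
Qed.

Lemma Series_term_le (u : nat -> R) (n : nat) :
  (forall k, 0 <= u k) -> ex_series u -> u n <= Series u.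
Proof.
  intros H Hu.
  apply Rle_trans with (sum_n u n).
  - destruct n as [|n].
    + rewrite sum_O; lra.
    + rewrite sum_Sn; unfold plus; simpl.
      assert (0 <= sum_n u n); [|lra].
      rewrite sum_n_Reals; apply cond_pos_sum; exact H.
  - apply (is_lim_seq_incr_compare (sum_n u) (Series u)).
    + exact (Series_correct u Hu).
    + intros k; rewrite sum_Sn; unfold plus; simpl.
      specialize (H (S k)); lra.
Qed.

Lemma Zseries_term_le (u : Z -> R) (j : Z) :
  (forall k, 0 <= u k) -> ex_Zseries u -> u j <= Zseries u.
Proof.
  intros H [H1 H2]; unfold Zseries.
  assert (N1 : 0 <= Series (fun n => u (Z.of_nat n))).
  { eapply Rle_trans; [|apply (Series_term_le _ 0%nat)]; auto; apply H. }
  assert (N2 : 0 <= Series (fun n => u (- Z.of_nat (S n))%Z)).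
  { eapply Rle_trans; [|apply (Series_term_le _ 0%nat)]; auto; apply H. }
  destruct (Z_le_gt_dec 0 j) as [Hj|Hj].
  - generalize (Series_term_le _ (Z.to_nat j) (fun n => H (Z.of_nat n)) H1).
    cbv beta; rewrite Z2Nat.id by lia; lra.
  - generalize (Series_term_le _ (Z.to_nat (- j - 1))
                  (fun n => H (- Z.of_nat (S n))%Z) H2).
    cbv beta; replace (- Z.of_nat (S (Z.to_nat (- j - 1))))%Z with j by lia.
    lra.
Qed.

(** The shift moves the single term [u 0] from the head of the nonnegative half to the head of the
    negative half; up to these heads the two halves are unchanged. *)
Lemma ex_Zseries_shift (u : Z -> R) :
  ex_Zseries u <-> ex_Zseries (fun j => u (j + 1)%Z).
Proof.
  unfold ex_Zseries.
  rewrite (ex_series_incr_1 (fun n => u (Z.of_nat n))).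
  rewrite (ex_series_incr_1 (fun n => u (- Z.of_nat (S n) + 1)%Z)).
  replace (fun n => u (Z.of_nat (S n))) with (fun n => u (Z.of_nat n + 1)%Z)
    by (extensionality n; f_equal; lia).
  replace (fun n => u (- Z.of_nat (S (S n)) + 1)%Z)
    with (fun n => u (- Z.of_nat (S n))%Z)
    by (extensionality n; f_equal; lia).
  reflexivity.
Qed.

Lemma Zseries_shift (u : Z -> R) :
  ex_Zseries u -> Zseries (fun j => u (j + 1)%Z) = Zseries u.
Proof.
  intros H; generalize H; intros [H1 _].
  apply ex_Zseries_shift in H; destruct H as [_ H2].
  unfold Zseries.
  rewrite (Series_incr_1 _ H1), (Series_incr_1 _ H2).
  replace (fun n => u (Z.of_nat (S n))) with (fun n => u (Z.of_nat n + 1)%Z)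
    by (extensionality n; f_equal; lia).
  replace (fun n => u (- Z.of_nat (S (S n)) + 1)%Z)
    with (fun n => u (- Z.of_nat (S n))%Z)
    by (extensionality n; f_equal; lia).
  simpl; ring.
Qed.

(** * The Hilbert space structure of real l^2(Z) *)

Definition ip (x y : Z -> R) : R := Zseries (fun j => x j * y j).

Lemma norm_sqr (x : Z -> R) :
  (fun j => norm (x j) ^ 2) = (fun j => x j * x j).
Proof.
  extensionality j.
  change (Rabs (x j) ^ 2 = x j * x j); rewrite pow2_abs; ring.
Qed.

Lemma in_l2_sqr (x : Z -> R) : in_l2 x <-> ex_Zseries (fun j => x j * x j).
Proof. unfold in_l2; rewrite norm_sqr; reflexivity. Qed.

Lemma l2norm_ip (x : Z -> R) : l2norm x = sqrt (ip x x).
Proof. unfold l2norm; rewrite norm_sqr; reflexivity. Qed.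

Lemma ex_ip (x y : Z -> R) :
  in_l2 x -> in_l2 y -> ex_Zseries (fun j => x j * y j).
Proof.
  rewrite !in_l2_sqr; intros Hx Hy.
  apply ex_Zseries_le with (fun j => x j * x j + y j * y j).
  - intros j; apply Rabs_le.
    generalize (Rle_0_sqr (x j - y j)), (Rle_0_sqr (x j + y j)),
      (Rle_0_sqr (x j)), (Rle_0_sqr (y j)).
    unfold Rsqr; intros; split; nra.
  - now apply ex_Zseries_plus.
Qed.

Lemma in_l2_plus (x y : Z -> R) :
  in_l2 x -> in_l2 y -> in_l2 (fun j => x j + y j).
Proof.
  intros Hx Hy; apply in_l2_sqr.
  replace (fun j => (x j + y j) * (x j + y j))
    with (fun j => (x j * x j + y j * y j) + 2 * (x j * y j))
    by (extensionality j; ring).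
  apply ex_Zseries_plus; [apply ex_Zseries_plus|apply ex_Zseries_scal];
    now apply ex_ip.
Qed.

Lemma in_l2_scal (c : R) (x : Z -> R) : in_l2 x -> in_l2 (fun j => c * x j).
Proof.
  intros Hx; apply in_l2_sqr.
  replace (fun j => (c * x j) * (c * x j))
    with (fun j => (c * c) * (x j * x j)) by (extensionality j; ring).
  now apply ex_Zseries_scal, ex_ip.
Qed.

Lemma in_l2_minus (x y : Z -> R) :
  in_l2 x -> in_l2 y -> in_l2 (fun j => x j - y j).
Proof.
  intros Hx Hy.
  replace (fun j => x j - y j) with (fun j => x j + (-1) * y j)
    by (extensionality j; ring).
  now apply in_l2_plus, in_l2_scal.
Qed.

Lemma in_l2_next (x : Z -> R) : in_l2 x -> in_l2 (fun j => x (j + 1)%Z).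
Proof.
  rewrite !in_l2_sqr; intros Hx.
  exact (proj1 (ex_Zseries_shift (fun j => x j * x j)) Hx).
Qed.

Lemma in_l2_prev (x : Z -> R) : in_l2 x -> in_l2 (fun j => x (j - 1)%Z).
Proof.
  rewrite !in_l2_sqr; intros Hx.
  apply ex_Zseries_shift.
  replace (fun j => x (j + 1 - 1)%Z * x (j + 1 - 1)%Z)
    with (fun j => x j * x j); trivial.
  extensionality j; replace (j + 1 - 1)%Z with j by lia; ring.
Qed.

Lemma ip_comm (x y : Z -> R) : ip x y = ip y x.
Proof. unfold ip; f_equal; extensionality j; ring. Qed.

Lemma ip_plus_l (x y z : Z -> R) :
  in_l2 x -> in_l2 y -> in_l2 z ->
  ip (fun j => x j + y j) z = ip x z + ip y z.
Proof.
  intros Hx Hy Hz; unfold ip.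
  rewrite <- Zseries_plus by now apply ex_ip.
  f_equal; extensionality j; ring.
Qed.

Lemma ip_scal_l (c : R) (x y : Z -> R) : ip (fun j => c * x j) y = c * ip x y.
Proof.
  unfold ip; rewrite <- Zseries_scal; f_equal; extensionality j; ring.
Qed.

Lemma ip_plus_r (x y z : Z -> R) :
  in_l2 x -> in_l2 y -> in_l2 z ->
  ip x (fun j => y j + z j) = ip x y + ip x z.
Proof.
  intros; rewrite ip_comm, ip_plus_l, (ip_comm y), (ip_comm z); auto.
Qed.

Lemma ip_scal_r (c : R) (x y : Z -> R) : ip x (fun j => c * y j) = c * ip x y.
Proof. rewrite ip_comm, ip_scal_l, ip_comm; reflexivity. Qed.

Lemma ip_next_r (x y : Z -> R) :
  in_l2 x -> in_l2 y ->
  ip x (fun j => y (j + 1)%Z) = ip (fun j => x (j - 1)%Z) y.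
Proof.
  intros Hx Hy; unfold ip.
  rewrite <- (Zseries_shift (fun j => x (j - 1)%Z * y j)).
  - f_equal; extensionality j; now replace (j + 1 - 1)%Z with j by lia.
  - apply ex_ip; trivial; now apply in_l2_prev.
Qed.

Lemma ip_ge0 (x : Z -> R) : in_l2 x -> 0 <= ip x x.
Proof.
  intros Hx; apply Zseries_ge0; [|now apply ex_ip].
  intros j; apply Rle_0_sqr.
Qed.

Lemma l2norm_ge0 (x : Z -> R) : 0 <= l2norm x.
Proof. apply sqrt_pos. Qed.

Lemma l2norm_sqr (x : Z -> R) : in_l2 x -> l2norm x * l2norm x = ip x x.
Proof. intros Hx; rewrite l2norm_ip; now apply sqrt_sqrt, ip_ge0. Qed.

(** Cauchy-Schwarz, from nonnegativity of the quadratic form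
    [(r, s) -> ip (r x + s y) (r x + s y)]. *)
Lemma ip_le (x y : Z -> R) :
  in_l2 x -> in_l2 y -> Rabs (ip x y) <= l2norm x * l2norm y.
Proof.
  intros Hx Hy.
  assert (Q : forall r s, 0 <= r * r * ip x x + 2 * r * s * ip x y + s * s * ip y y).
  { intros r s.
    assert (Hr := in_l2_scal r x Hx); assert (Hs := in_l2_scal s y Hy).
    generalize (ip_ge0 _ (in_l2_plus _ _ Hr Hs)).
    rewrite ip_plus_l, !ip_plus_r, !ip_scal_l, !ip_scal_r, (ip_comm y x);
      auto using in_l2_plus; lra. }
  assert (Px := ip_ge0 x Hx); assert (Py := ip_ge0 y Hy).
  rewrite !l2norm_ip, <- sqrt_mult by trivial.
  rewrite <- sqrt_Rsqr_abs; apply sqrt_le_1_alt; unfold Rsqr.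
  set (p := ip x x) in *; set (q := ip y y) in *; set (s := ip x y) in *.
  destruct (Rle_lt_or_eq_dec _ _ Py) as [Hq|Hq].
  (* At [(q, - s)] the form equals [q * (p * q - s * s)], and [q > 0] can be cancelled. *)
  - generalize (Q q (- s)); nra.
  - (* [q = 0]: positivity for all [r] forces [s = 0]. *)
    generalize (Q s (- (1 + p))); rewrite <- Hq; nra.
Qed.

Lemma l2norm_triangle (x y : Z -> R) :
  in_l2 x -> in_l2 y -> l2norm (fun j => x j + y j) <= l2norm x + l2norm y.
Proof.
  intros Hx Hy.
  apply Rsqr_incr_0;
    [|apply l2norm_ge0|apply Rplus_le_le_0_compat; apply l2norm_ge0].
  unfold Rsqr; rewrite l2norm_sqr by now apply in_l2_plus.
  rewrite ip_plus_l, !ip_plus_r, (ip_comm y x); auto using in_l2_plus.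
  rewrite <- !l2norm_sqr by trivial.
  generalize (ip_le x y Hx Hy), (Rle_abs (ip x y)); lra.
Qed.

Lemma l2norm_scal (c : R) (x : Z -> R) :
  l2norm (fun j => c * x j) = Rabs c * l2norm x.
Proof.
  rewrite !l2norm_ip, ip_scal_l, ip_scal_r, <- Rmult_assoc.
  rewrite sqrt_mult_alt by apply Rle_0_sqr.
  now rewrite <- sqrt_Rsqr_abs.
Qed.

Lemma l2norm_next (x : Z -> R) :
  in_l2 x -> l2norm (fun j => x (j + 1)%Z) = l2norm x.
Proof.
  intros Hx; rewrite !l2norm_ip; f_equal.
  apply (Zseries_shift (fun j => x j * x j)); now apply ex_ip.
Qed.

Lemma l2norm_prev (x : Z -> R) :
  in_l2 x -> l2norm (fun j => x (j - 1)%Z) = l2norm x.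
Proof.
  intros Hx; rewrite <- (l2norm_next _ (in_l2_prev x Hx)); f_equal.
  extensionality j; f_equal; lia.
Qed.

Lemma l2_le (x y : Z -> R) :
  (forall j, Rabs (x j) <= Rabs (y j)) -> in_l2 y ->
  in_l2 x /\ l2norm x <= l2norm y.
Proof.
  intros H Hy.
  assert (H' : forall j, 0 <= x j * x j <= y j * y j).
  { intros j; split; [apply Rle_0_sqr|apply Rsqr_le_abs_1, H]. }
  split.
  - apply in_l2_sqr; apply in_l2_sqr in Hy; revert Hy; apply ex_Zseries_le.
    intros j; rewrite Rabs_pos_eq; apply H'.
  - rewrite !l2norm_ip; apply sqrt_le_1_alt, Zseries_le; trivial.
    now apply ex_ip.
Qed.

Lemma l2norm_term_le (x : Z -> R) (j : Z) : in_l2 x -> Rabs (x j) <= l2norm x.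
Proof.
  intros Hx; rewrite l2norm_ip, <- sqrt_Rsqr_abs; apply sqrt_le_1_alt.
  apply (Zseries_term_le (fun k => x k * x k)).
  - intros k; apply Rle_0_sqr.
  - now apply ex_ip.
Qed.

Lemma l2_mult_bounded (m : R) (x y : Z -> R) :
  (forall j, Rabs (x j) <= m) -> in_l2 y ->
  in_l2 (fun j => x j * y j) /\ l2norm (fun j => x j * y j) <= m * l2norm y.
Proof.
  intros H Hy.
  assert (Hm : 0 <= m) by (generalize (H 0%Z), (Rabs_pos (x 0%Z)); lra).
  rewrite <- (Rabs_pos_eq m) by trivial; rewrite <- l2norm_scal.
  apply l2_le; [|now apply in_l2_scal].
  intros j; rewrite !Rabs_mult, (Rabs_pos_eq m) by trivial.
  apply Rmult_le_compat_r; [apply Rabs_pos|apply H].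
Qed.

(** The l^2 norm dominates the supremum norm, which makes l^2(Z) an algebra under the pointwise
    product; the cubic nonlinearities act on it for this reason. *)
Lemma in_l2_mult (x y : Z -> R) :
  in_l2 x -> in_l2 y -> in_l2 (fun j => x j * y j).
Proof.
  intros Hx Hy.
  now apply (l2_mult_bounded (l2norm x)); [intros; apply l2norm_term_le|].
Qed.

Lemma l2norm_mult (x y : Z -> R) :
  in_l2 x -> in_l2 y -> l2norm (fun j => x j * y j) <= l2norm x * l2norm y.
Proof.
  intros Hx Hy.
  now apply (l2_mult_bounded (l2norm x)); [intros; apply l2norm_term_le|].
Qed.

(** * Differentiable curves in l^2(Z) *)

Definition diff_quot (x v : R -> Z -> R) (t h : R) (j : Z) : R :=
  / h * (x (t + h) j - x t j) - v t j.

(** Global in time and bundled with membership in l^2(Z), so that the rules of calculus below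
    compose without side conditions. *)
Definition l2_deriv (x v : R -> Z -> R) : Prop :=
  forall t, in_l2 (x t) /\ in_l2 (v t) /\
    is_lim (fun h => l2norm (diff_quot x v t h)) 0 0.

Lemma l2_deriv_in (x v : R -> Z -> R) (t : R) : l2_deriv x v -> in_l2 (x t).
Proof. intros H; exact (proj1 (H t)). Qed.

Lemma l2_deriv_in' (x v : R -> Z -> R) (t : R) : l2_deriv x v -> in_l2 (v t).
Proof. intros H; exact (proj1 (proj2 (H t))). Qed.

Lemma l2_deriv_lim (x v : R -> Z -> R) (t : R) :
  l2_deriv x v -> is_lim (fun h => l2norm (diff_quot x v t h)) 0 0.
Proof. intros H; exact (proj2 (proj2 (H t))). Qed.

Lemma diff_quot_in_l2 (x v : R -> Z -> R) (t h : R) :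
  (forall s, in_l2 (x s)) -> in_l2 (v t) -> in_l2 (diff_quot x v t h).
Proof.
  intros Hx Hv.
  apply (in_l2_minus (fun j => / h * (x (t + h) j - x t j)) (v t)); trivial.
  apply (in_l2_scal (/ h) (fun j => x (t + h) j - x t j)).
  now apply in_l2_minus.
Qed.

Lemma in_l2_diff_quot (x v : R -> Z -> R) (t h : R) :
  l2_deriv x v -> in_l2 (diff_quot x v t h).
Proof.
  intros H; apply diff_quot_in_l2;
    [intros s; exact (l2_deriv_in x v s H)|exact (l2_deriv_in' x v t H)].
Qed.

Lemma is_lim_squeeze0 (f g : R -> R) :
  (forall h, h <> 0 -> 0 <= f h <= g h) -> is_lim g 0 0 -> is_lim f 0 0.
Proof.
  intros H Hg.
  apply (is_lim_le_le_loc (fun _ => 0) g); [|apply is_lim_const|exact Hg].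
  exists (mkposreal 1 Rlt_0_1); intros h _ Hh; now apply H.
Qed.

Lemma is_lim_plus0 (f g : R -> R) :
  is_lim f 0 0 -> is_lim g 0 0 -> is_lim (fun h => f h + g h) 0 0.
Proof.
  intros Hf Hg; generalize (is_lim_plus' f g 0 0 0 Hf Hg).
  now rewrite Rplus_0_l.
Qed.

Lemma is_lim_mult0 (f g : R -> R) (l : R) :
  is_lim f 0 0 -> is_lim g 0 l -> is_lim (fun h => f h * g h) 0 0.
Proof.
  intros Hf Hg.
  generalize (is_lim_mult f g 0 0 l Hf Hg I); simpl; now rewrite Rmult_0_l.
Qed.

Lemma l2_deriv_eq (x v w : R -> Z -> R) :
  l2_deriv x v -> (forall t j, v t j = w t j) -> l2_deriv x w.
Proof.
  intros H E; replace w with v; trivial.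
  extensionality t; extensionality j; apply E.
Qed.

Lemma l2_deriv_eq_l (x y v : R -> Z -> R) :
  l2_deriv x v -> (forall t j, x t j = y t j) -> l2_deriv y v.
Proof.
  intros H E; replace y with x; trivial.
  extensionality t; extensionality j; apply E.
Qed.

Lemma l2_deriv_plus (x y v w : R -> Z -> R) :
  l2_deriv x v -> l2_deriv y w ->
  l2_deriv (fun t j => x t j + y t j) (fun t j => v t j + w t j).
Proof.
  intros Hx Hy t; split; [|split]; try (apply in_l2_plus;
    eauto using l2_deriv_in, l2_deriv_in').
  apply is_lim_squeeze0 with
    (fun h => l2norm (diff_quot x v t h) + l2norm (diff_quot y w t h));
    [|apply is_lim_plus0; now apply l2_deriv_lim].
  intros h _; split; [apply l2norm_ge0|].
  eapply Rle_trans; [|apply l2norm_triangle; now apply in_l2_diff_quot].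
  right; f_equal; extensionality j; unfold diff_quot; ring.
Qed.

Lemma l2_deriv_scal (c : R) (x v : R -> Z -> R) :
  l2_deriv x v -> l2_deriv (fun t j => c * x t j) (fun t j => c * v t j).
Proof.
  intros Hx t; split; [|split]; try (apply in_l2_scal;
    eauto using l2_deriv_in, l2_deriv_in').
  apply is_lim_squeeze0 with (fun h => l2norm (diff_quot x v t h) * Rabs c);
    [|eapply is_lim_mult0; [now apply l2_deriv_lim|apply is_lim_const]].
  intros h _; split; [apply l2norm_ge0|].
  rewrite Rmult_comm, <- l2norm_scal.
  right; f_equal; extensionality j; unfold diff_quot; ring.
Qed.

Lemma l2_deriv_minus (x y v w : R -> Z -> R) :
  l2_deriv x v -> l2_deriv y w ->
  l2_deriv (fun t j => x t j - y t j) (fun t j => v t j - w t j).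
Proof.
  intros Hx Hy.
  eapply l2_deriv_eq; [eapply l2_deriv_eq_l|].
  - apply (l2_deriv_plus _ _ _ _ Hx (l2_deriv_scal (-1) _ _ Hy)).
  - intros; simpl; ring.
  - intros; simpl; ring.
Qed.

Lemma l2_deriv_next (x v : R -> Z -> R) :
  l2_deriv x v ->
  l2_deriv (fun t j => x t (j + 1)%Z) (fun t j => v t (j + 1)%Z).
Proof.
  intros Hx t; split; [|split]; try (apply in_l2_next;
    eauto using l2_deriv_in, l2_deriv_in').
  apply is_lim_squeeze0 with (fun h => l2norm (diff_quot x v t h));
    [|now apply l2_deriv_lim].
  intros h _; split; [apply l2norm_ge0|].
  right; rewrite <- (l2norm_next (diff_quot x v t h)); trivial.
  now apply in_l2_diff_quot.
Qed.

Lemma l2_deriv_prev (x v : R -> Z -> R) :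
  l2_deriv x v ->
  l2_deriv (fun t j => x t (j - 1)%Z) (fun t j => v t (j - 1)%Z).
Proof.
  intros Hx t; split; [|split]; try (apply in_l2_prev;
    eauto using l2_deriv_in, l2_deriv_in').
  apply is_lim_squeeze0 with (fun h => l2norm (diff_quot x v t h));
    [|now apply l2_deriv_lim].
  intros h _; split; [apply l2norm_ge0|].
  right; rewrite <- (l2norm_prev (diff_quot x v t h)); trivial.
  now apply in_l2_diff_quot.
Qed.

Lemma is_lim_Rabs_id : is_lim Rabs 0 0.
Proof.
  rewrite <- Rabs_R0 at 2; apply is_lim_continuity, Rcontinuity_abs.
Qed.

Lemma l2_deriv_continuous (x v : R -> Z -> R) (t : R) :
  l2_deriv x v -> is_lim (fun h => l2norm (fun j => x (t + h) j - x t j)) 0 0.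
Proof.
  intros Hx.
  apply is_lim_squeeze0 with
    (fun h => Rabs h * (l2norm (diff_quot x v t h) + l2norm (v t))).
  - intros h Hh; split; [apply l2norm_ge0|].
    eapply Rle_trans;
      [|apply Rmult_le_compat_l;
        [apply Rabs_pos|apply l2norm_triangle;
          [now apply in_l2_diff_quot|exact (l2_deriv_in' x v t Hx)]]].
    rewrite <- l2norm_scal; right; f_equal; extensionality j.
    unfold diff_quot; now field.
  - eapply is_lim_mult0; [exact is_lim_Rabs_id|].
    apply is_lim_plus'; [now apply l2_deriv_lim|apply is_lim_const].
Qed.

Lemma l2_deriv_norm_continuous (x v : R -> Z -> R) (t : R) :
  l2_deriv x v -> is_lim (fun h => l2norm (x (t + h))) 0 (l2norm (x t)).
Proof.
  intros Hx.
  apply (is_lim_le_le_loc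
           (fun h => l2norm (x t) - l2norm (fun j => x (t + h) j - x t j))
           (fun h => l2norm (x t) + l2norm (fun j => x (t + h) j - x t j))).
  - exists (mkposreal 1 Rlt_0_1); intros h _ _.
    assert (H1 := l2_deriv_in x v (t + h) Hx); assert (H0 := l2_deriv_in x v t Hx).
    assert (HD := in_l2_minus _ _ H1 H0).
    generalize (l2norm_triangle _ _ H0 HD).
    generalize (l2norm_triangle _ _ H1 (in_l2_scal (-1) _ HD)).
    rewrite l2norm_scal, (Rabs_left (-1)) by lra.
    replace (fun j => x (t + h) j + -1 * (x (t + h) j - x t j)) with (x t)
      by (extensionality j; ring).
    replace (fun j => x t j + (x (t + h) j - x t j)) with (x (t + h))
      by (extensionality j; ring).
    lra.
  - generalize (is_lim_minus' _ _ 0 _ _ (is_lim_const (l2norm (x t)) 0)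
                  (l2_deriv_continuous x v t Hx)).
    now rewrite Rminus_0_r.
  - generalize (is_lim_plus' _ _ 0 _ _ (is_lim_const (l2norm (x t)) 0)
                  (l2_deriv_continuous x v t Hx)).
    now rewrite Rplus_0_r.
Qed.

(* Common bound for the product rules of the pointwise and the scalar product. *)
Lemma product_rule_lim (x y v w : R -> Z -> R) (t : R) :
  l2_deriv x v -> l2_deriv y w ->
  is_lim (fun h =>
    l2norm (diff_quot x v t h) * l2norm (y (t + h))
    + (l2norm (fun j => y (t + h) j - y t j) * l2norm (v t)
       + l2norm (diff_quot y w t h) * l2norm (x t))) 0 0.
Proof.
  intros Hx Hy; apply is_lim_plus0; [|apply is_lim_plus0].
  - exact (is_lim_mult0 _ _ _ (l2_deriv_lim x v t Hx)
             (l2_deriv_norm_continuous y w t Hy)).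
  - exact (is_lim_mult0 _ _ _ (l2_deriv_continuous y w t Hy)
             (is_lim_const (l2norm (v t)) 0)).
  - exact (is_lim_mult0 _ _ _ (l2_deriv_lim y w t Hy)
             (is_lim_const (l2norm (x t)) 0)).
Qed.

Lemma l2_deriv_mult (x y v w : R -> Z -> R) :
  l2_deriv x v -> l2_deriv y w ->
  l2_deriv (fun t j => x t j * y t j)
    (fun t j => v t j * y t j + x t j * w t j).
Proof.
  intros Hx Hy t.
  assert (X := fun s => l2_deriv_in x v s Hx); assert (Y := fun s => l2_deriv_in y w s Hy).
  assert (V := fun s => l2_deriv_in' x v s Hx).
  assert (W := fun s => l2_deriv_in' y w s Hy).
  split; [|split].
  - now apply in_l2_mult.
  - now apply in_l2_plus; apply in_l2_mult.
  - eapply is_lim_squeeze0; [|exact (product_rule_lim x y v w t Hx Hy)].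
    intros h _; split; [apply l2norm_ge0|].
    assert (DX := in_l2_diff_quot x v t h Hx).
    assert (DY := in_l2_diff_quot y w t h Hy).
    assert (D := in_l2_minus _ _ (Y (t + h)) (Y t)).
    (* The first term keeps [y] at time [t + h]; the mismatch is the middle term, which vanishes by
       continuity of [y]. *)
    replace (diff_quot (fun t j => x t j * y t j)
               (fun t j => v t j * y t j + x t j * w t j) t h)
      with (fun j => diff_quot x v t h j * y (t + h) j
                     + ((y (t + h) j - y t j) * v t j
                        + diff_quot y w t h j * x t j))
      by (extensionality j; unfold diff_quot; ring).
    eapply Rle_trans; [apply l2norm_triangle|apply Rplus_le_compat];
      auto using in_l2_plus, in_l2_mult, l2norm_mult.
    eapply Rle_trans; [apply l2norm_triangle|apply Rplus_le_compat];
      auto using in_l2_plus, in_l2_mult, l2norm_mult.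
Qed.

Lemma is_derive_lim (f : R -> R) (t l : R) :
  is_lim (fun h => Rabs (/ h * (f (t + h) - f t) - l)) 0 0 -> is_derive f t l.
Proof.
  intros H; apply is_derive_Reals; intros e He.
  apply is_lim_spec in H; destruct (H (mkposreal e He)) as [d Hd].
  exists d; intros h Hh Hhd.
  generalize (Hd h); simpl; rewrite Rminus_0_r, Rabs_Rabsolu.
  unfold Rdiv; rewrite Rmult_comm; intros Hc; apply Hc; trivial.
  change (Rabs (h - 0) < d); now rewrite Rminus_0_r.
Qed.

Lemma l2_deriv_component (x v : R -> Z -> R) (t : R) (j : Z) :
  l2_deriv x v -> is_derive (fun s => x s j) t (v t j).
Proof.
  intros Hx; apply is_derive_lim.
  eapply is_lim_squeeze0; [|exact (proj2 (proj2 (Hx t)))].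
  intros h _; split; [apply Rabs_pos|].
  apply (l2norm_term_le (diff_quot x v t h) j); now apply in_l2_diff_quot.
Qed.

(** Convergence in norm controls every component. This replaces the componentwise [dot] of the
    approximation by its explicit derivative. *)
Lemma l2_deriv_dot (x v : R -> Z -> R) : l2_deriv x v -> dot x = v.
Proof.
  intros Hx; extensionality t; extensionality j.
  now apply is_derive_unique, l2_deriv_component.
Qed.

Lemma ip_deriv (x y v w : R -> Z -> R) (t : R) :
  l2_deriv x v -> l2_deriv y w ->
  is_derive (fun s => ip (x s) (y s)) t (ip (v t) (y t) + ip (x t) (w t)).
Proof.
  intros Hx Hy; apply is_derive_lim.
  assert (X := fun s => l2_deriv_in x v s Hx); assert (Y := fun s => l2_deriv_in y w s Hy).
  assert (V := fun s => l2_deriv_in' x v s Hx).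
  assert (W := fun s => l2_deriv_in' y w s Hy).
  eapply is_lim_squeeze0; [|exact (product_rule_lim x y v w t Hx Hy)].
  intros h _; split; [apply Rabs_pos|].
  assert (DX := in_l2_diff_quot x v t h Hx).
  assert (DY := in_l2_diff_quot y w t h Hy).
  assert (D := in_l2_minus _ _ (Y (t + h)) (Y t)).
  assert (E : / h * (ip (x (t + h)) (y (t + h)) - ip (x t) (y t))
                - (ip (v t) (y t) + ip (x t) (w t))
              = ip (diff_quot x v t h) (y (t + h))
                + (ip (fun j => y (t + h) j - y t j) (v t)
                   + ip (diff_quot y w t h) (x t))).
  { assert (F : forall a b c d : Z -> R,
      in_l2 a -> in_l2 b -> in_l2 c -> in_l2 d ->
      ip (fun j => / h * (a j - b j) - c j) d
      = / h * (ip a d - ip b d) - ip c d).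
    { intros a b c d Ha Hb Hc Hd.
      replace (fun j => / h * (a j - b j) - c j)
        with (fun j => / h * (a j + (-1) * b j) + (-1) * c j)
        by (extensionality j; ring).
      rewrite ip_plus_l, ip_scal_l, ip_plus_l, !ip_scal_l;
        auto using in_l2_scal, in_l2_plus; ring. }
    assert (G : ip (fun j => y (t + h) j - y t j) (v t)
                = ip (y (t + h)) (v t) - ip (y t) (v t)).
    { replace (fun j => y (t + h) j - y t j)
        with (fun j => y (t + h) j + (-1) * y t j) by (extensionality j; ring).
      rewrite ip_plus_l, ip_scal_l; auto using in_l2_scal; ring. }
    unfold diff_quot; rewrite !F, G by trivial.
    rewrite (ip_comm (y (t + h)) (x t)), (ip_comm (y t) (x t)),
      (ip_comm (w t) (x t)), (ip_comm (y (t + h)) (v t)),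
      (ip_comm (y t) (v t)).
    ring. }
  rewrite E.
  eapply Rle_trans; [apply Rabs_triang|apply Rplus_le_compat];
    [now apply ip_le|].
  eapply Rle_trans; [apply Rabs_triang|apply Rplus_le_compat]; now apply ip_le.
Qed.

(** Serves the rotation by [cos t] and [sin t]: these factors do not depend on [j], hence are not
    curves in l^2(Z), and [l2_deriv_mult] does not cover them. *)
Lemma l2_deriv_mult_fun (f g : R -> R) (x v : R -> Z -> R) :
  (forall t, is_derive f t (g t)) -> l2_deriv x v ->
  l2_deriv (fun t j => f t * x t j) (fun t j => g t * x t j + f t * v t j).
Proof.
  intros Hf Hx t.
  assert (X := fun s => l2_deriv_in x v s Hx).
  assert (V := fun s => l2_deriv_in' x v s Hx).
  split; [|split]; auto using in_l2_plus, in_l2_scal.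
  apply is_lim_squeeze0 with (fun h =>
    Rabs (/ h * (f (t + h) - f t) - g t) * l2norm (x t)
    + (l2norm (diff_quot x v t h) * Rabs (f (t + h))
       + Rabs (f (t + h) - f t) * l2norm (v t))).
  - intros h _; split; [apply l2norm_ge0|].
    rewrite (Rmult_comm (l2norm (diff_quot x v t h))), <- !l2norm_scal.
    assert (DX := in_l2_diff_quot x v t h Hx).
    eapply Rle_trans;
      [|apply Rplus_le_compat_l, l2norm_triangle; auto using in_l2_scal].
    eapply Rle_trans; [|apply l2norm_triangle; auto using in_l2_plus, in_l2_scal].
    right; f_equal; extensionality j; unfold diff_quot; ring.
  - assert (L : is_lim (fun h => f (t + h)) 0 (f t)).
    { apply (is_lim_ext (fun h => f (1 * h + t))).
      - intros; f_equal; ring.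
      - apply (is_lim_comp_lin f 1 t 0 (f t)); [|lra].
        simpl; replace (1 * 0 + t) with t by ring.
        apply is_lim_continuity, derivable_continuous_pt.
        exists (g t); now apply is_derive_Reals. }
    apply is_lim_plus0; [|apply is_lim_plus0].
    + eapply is_lim_mult0; [|apply is_lim_const].
      apply is_lim_spec; intros e.
      generalize (Hf t); intros H; apply is_derive_Reals in H.
      destruct (H e (cond_pos e)) as [d Hd].
      exists d; intros h Hh Hh0.
      rewrite Rminus_0_r, Rabs_Rabsolu, Rmult_comm; apply Hd; trivial.
      change (Rabs (h - 0) < d) in Hh; now rewrite Rminus_0_r in Hh.
    + eapply is_lim_mult0; [now apply l2_deriv_lim|].
      apply (is_lim_Rabs _ _ _ L).
    + eapply is_lim_mult0; [|apply is_lim_const].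
      generalize (is_lim_Rabs _ _ _
        (is_lim_minus' _ _ _ _ _ L (is_lim_const (f t) 0))).
      simpl; rewrite Rminus_diag, Rabs_R0; trivial.
Qed.

Lemma l2_deriv_comp_scal (c : R) (x v : R -> Z -> R) :
  c <> 0 -> l2_deriv x v ->
  l2_deriv (fun t j => x (c * t) j) (fun t j => c * v (c * t) j).
Proof.
  intros Hc Hx t; split; [|split].
  - exact (l2_deriv_in _ _ _ Hx).
  - apply in_l2_scal; exact (l2_deriv_in' _ _ _ Hx).
  (* The [+ 0] matches the affine substitution in [is_lim_comp_lin]. *)
  - apply is_lim_squeeze0 with
      (fun h => l2norm (diff_quot x v (c * t) (c * h + 0)) * Rabs c).
    + intros h Hh; split; [apply l2norm_ge0|].
      rewrite Rmult_comm, <- l2norm_scal; right; f_equal; extensionality j.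
      unfold diff_quot.
      replace (c * t + (c * h + 0)) with (c * (t + h)) by ring.
      now field.
    + eapply is_lim_mult0; [|apply is_lim_const].
      apply (is_lim_comp_lin (fun h => l2norm (diff_quot x v (c * t) h)));
        trivial.
      simpl; rewrite Rmult_0_r, Rplus_0_l; now apply l2_deriv_lim.
Qed.

(** * A Gronwall inequality with a bootstrap *)

(** Continuity method: at the supremum [c] of the times up to which [f <= e], the hypothesis gives
    the strict bound, and continuity would carry it past [c] if [c < T]. At [t = 0] the premise is
    vacuous, so the hypothesis also supplies the initial bound. *)
Lemma bootstrap (f : R -> R) (T e : R) :
  (forall t, continuity_pt f t) ->
  (forall t, 0 <= t <= T -> (forall s, 0 <= s < t -> f s <= e) -> f t < e) ->
  forall t, 0 <= t <= T -> f t < e.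
Proof.
  intros Hc H.
  assert (Hnear : forall t, f t < e ->
            exists d, 0 < d /\ forall s, Rabs (s - t) < d -> f s < e).
  { intros t Ht.
    destruct (Hc t (e - f t)) as [d [Hd Hs]]; [lra|].
    exists d; split; trivial; intros s Hst.
    destruct (Req_dec s t) as [->|Hne]; trivial.
    assert (K : Rabs (f s - f t) < e - f t).
    { apply Hs; split; [split; [exact I|congruence]|exact Hst]. }
    apply Rabs_def2 in K; lra. }
  intros t0 Ht0.
  set (P := fun t => 0 <= t <= T /\ forall s, 0 <= s < t -> f s <= e).
  destruct (completeness P) as [c [Hub Hlub]].
  { exists T; intros t [Ht _]; lra. }
  { exists 0; split; [lra|intros; lra]. }
  assert (H0c : 0 <= c) by (apply Hub; split; [lra|intros; lra]).
  assert (HcT : c <= T) by (apply Hlub; intros t [Ht _]; lra).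
  (* [P] constrains only times strictly before its argument, and therefore passes to the
     supremum. *)
  assert (Pc : forall s, 0 <= s < c -> f s <= e).
  { intros s Hs; destruct (Rle_dec (f s) e) as [|Hn]; trivial.
    assert (c <= s); [|lra].
    apply Hlub; intros t [Ht1 Ht2].
    destruct (Rle_dec t s); trivial; exfalso; apply Hn, Ht2; lra. }
  assert (Hfc : f c < e) by (apply H; [lra|exact Pc]).
  assert (HTc : c = T).
  { destruct (Req_dec c T) as [|Hne]; trivial; exfalso.
    destruct (Hnear c Hfc) as [d [Hd Hs]].
    set (c' := Rmin T (c + d / 2)).
    assert (Hc' : c < c' <= T /\ c' <= c + d / 2).
    { unfold c'; split; [split|]; [apply Rmin_glb_lt; lra| |];
        [apply Rmin_l|apply Rmin_r]. }
    assert (c' <= c); [|lra].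
    apply Hub; split; [lra|].
    intros s Hs'; destruct (Rlt_dec s c); [apply Pc; lra|].
    left; apply Hs, Rabs_def1; lra. }
  apply H; trivial; intros s Hs; apply Pc; lra.
Qed.

(** Integrating factor: [(E + B / lam) * exp (- lam * t)] is nonincreasing. *)
Lemma gronwall (E dE : R -> R) (lam B T : R) :
  0 < lam -> 0 <= B -> (forall t, is_derive E t (dE t)) ->
  (forall t, 0 <= t < T -> dE t <= lam * E t + B) -> 0 <= T ->
  E T <= (E 0 + B / lam) * exp (lam * T).
Proof.
  intros Hlam HB HE HdE HT.
  assert (HBl : 0 <= B / lam)
    by (apply Rmult_le_pos; [|left; apply Rinv_0_lt_compat]; trivial).
  destruct (Rle_lt_or_eq_dec _ _ HT) as [HT'|<-];
    [|rewrite Rmult_0_r, exp_0; lra].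
  set (g := fun t => (E t + B / lam) * exp (- lam * t)).
  set (dg := fun t => (dE t - lam * E t - B) * exp (- lam * t)).
  assert (Hg : forall t, is_derive g t (dg t)).
  { intros t; unfold g, dg.
    evar_last; [apply (is_derive_mult (fun t => E t + B / lam)
                         (fun t => exp (- lam * t)))|].
    - apply (is_derive_plus E (fun _ => B / lam)); [apply HE|].
      apply is_derive_const.
    - auto_derive; trivial.
    - intros; apply Rmult_comm.
    - unfold plus, mult, zero; simpl; field; lra. }
  assert (Hle : g T <= g 0).
  (* The mean value point is interior, so the inequality on the half-open interval suffices; this is
     the range that [bootstrap] provides. *)
  { destruct (MVT_cor2 g dg 0 T HT') as [c [Hgc Hc]].
    - intros; apply is_derive_Reals, Hg.
    - assert (dg c <= 0).
      { unfold dg; generalize (HdE c ltac:(lra)), (exp_pos (- lam * c)); nra. }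
      nra. }
  unfold g in Hle; rewrite Rmult_0_r, exp_0, Rmult_1_r in Hle.
  apply (Rmult_le_compat_r (exp (lam * T))) in Hle; [|left; apply exp_pos].
  rewrite Rmult_assoc, <- exp_plus in Hle.
  replace (- lam * T + lam * T) with 0 in Hle by ring.
  rewrite exp_0 in Hle; lra.
Qed.

(** The differential inequality is available only while [E <= e]; as the resulting Gronwall bound
    lies below [e], the continuity method extends it to the whole interval. *)
Lemma gronwall_bootstrap (E dE : R -> R) (lam B e T : R) :
  0 < lam -> 0 <= B -> (forall t, is_derive E t (dE t)) -> 0 <= E 0 ->
  (forall t, 0 <= t <= T -> E t <= e -> dE t <= lam * E t + B) ->
  (E 0 + B / lam) * exp (lam * T) < e ->
  forall t, 0 <= t <= T -> E t < e /\ E t <= (E 0 + B / lam) * exp (lam * T).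
Proof.
  intros Hlam HB HE HE0 HdE He.
  assert (HBl : 0 <= B / lam)
    by (apply Rmult_le_pos; [|left; apply Rinv_0_lt_compat]; trivial).
  assert (K : forall t, 0 <= t <= T -> (forall s, 0 <= s < t -> E s <= e) ->
            E t <= (E 0 + B / lam) * exp (lam * T)).
  { intros t Ht Hs.
    eapply Rle_trans; [apply (gronwall E dE lam B t); trivial; try lra|].
    - intros s Hst; apply HdE; [lra|now apply Hs].
    - apply Rmult_le_compat_l; [lra|].
      destruct (Rle_lt_or_eq_dec t T (proj2 Ht)) as [| ->]; [|lra].
      left; apply exp_increasing, Rmult_lt_compat_l; trivial. }
  assert (L : forall t, 0 <= t <= T -> E t < e).
  { apply bootstrap.
    - intros t; apply derivable_continuous_pt; exists (dE t).
      apply is_derive_Reals, HE.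
    - intros t Ht Hs; specialize (K t Ht Hs); lra. }
  intros t Ht; split; [now apply L|apply K; trivial].
  intros s Hs; left; apply L; lra.
Qed.

(** A bound on [Rabs (dE t)] is invariant under time reversal, so negative times reduce to the
    forward estimate for [E (- s)]. *)
Lemma gronwall_bootstrap_two_sided (E dE : R -> R) (lam B e T : R) :
  0 < lam -> 0 <= B -> (forall t, is_derive E t (dE t)) -> 0 <= E 0 ->
  (forall t, E t <= e -> Rabs (dE t) <= lam * E t + B) ->
  (E 0 + B / lam) * exp (lam * T) < e ->
  forall t, - T <= t <= T -> E t < e /\ E t <= (E 0 + B / lam) * exp (lam * T).
Proof.
  intros Hlam HB HE HE0 HdE He t Ht.
  destruct (Rle_dec 0 t) as [Hp|Hn].
  - apply (gronwall_bootstrap E dE); trivial; [|lra].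
    intros s _ Hs; generalize (HdE s Hs), (Rle_abs (dE s)); lra.
  - generalize (gronwall_bootstrap (fun s => E (- s)) (fun s => - dE (- s))
                  lam B e T).
    rewrite Ropp_0; intros G.
    rewrite <- (Ropp_involutive t); apply G; trivial; [| |lra].
    + intros s; evar_last.
      * apply (is_derive_comp E (fun s => - s) s (dE (- s)) (-1));
          [apply HE|auto_derive; trivial].
      * unfold scal; simpl; unfold mult; simpl; ring.
    + intros s _ Hs; generalize (HdE _ Hs), (Rabs_maj2 (dE (- s))); lra.
Qed.

(** * The approximation in the rotating frame *)

Definition nbr (x : Z -> R) (j : Z) : R := x (j + 1)%Z + x (j - 1)%Z.

(* In the rotating frame [b(t) = a(eps t) exp(it) = u + iw], the dNLS equation
   with [nu = rho/eps] reads [u' = - w + eps vf(u,w)], [w' = u - eps vf(w,u)]. *)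
Definition vf (nu : R) (u w : Z -> R) (j : Z) : R :=
  / 2 * nbr w j - 3 / 2 * nu * ((u j * u j + w j * w j) * w j).

Definition dvf (nu : R) (u w u1 w1 : Z -> R) (j : Z) : R :=
  / 2 * nbr w1 j
  - 3 / 2 * nu * (2 * (u j * u1 j + w j * w1 j) * w j
                  + (u j * u j + w j * w j) * w1 j).

Definition du (eps nu : R) (u w : Z -> R) (j : Z) : R :=
  - w j + eps * vf nu u w j.

Definition dw (eps nu : R) (u w : Z -> R) (j : Z) : R :=
  u j - eps * vf nu w u j.

Definition ddu (eps nu : R) (u w : Z -> R) (j : Z) : R :=
  - dw eps nu u w j
  + eps * dvf nu u w (du eps nu u w) (dw eps nu u w) j.

Definition ddw (eps nu : R) (u w : Z -> R) (j : Z) : R :=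
  du eps nu u w j
  - eps * dvf nu w u (dw eps nu u w) (du eps nu u w) j.

(* [Re (b^3)], from the third harmonic of the leading-order approximation. *)
Definition cub (u w : Z -> R) (j : Z) : R :=
  u j * u j * u j - 3 * (u j * (w j * w j)).

Definition approx (rho : R) (u w : Z -> R) (j : Z) : R :=
  2 * u j + rho / 4 * cub u w j.

Definition dapprox (rho : R) (u w u1 w1 : Z -> R) (j : Z) : R :=
  2 * u1 j
  + rho / 4 * (3 * (u j * u j * u1 j) - 3 * (u1 j * (w j * w j))
               - 6 * (u j * (w j * w1 j))).

Definition ddapprox (rho : R) (u w u1 w1 u2 w2 : Z -> R) (j : Z) : R :=
  2 * u2 j
  + rho / 4 * (6 * (u j * (u1 j * u1 j)) + 3 * (u j * u j * u2 j)
               - 3 * (u2 j * (w j * w j)) - 12 * (u1 j * (w j * w1 j))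
               - 6 * (u j * (w1 j * w1 j)) - 6 * (u j * (w j * w2 j))).

(* The defect of [approx] in the Klein-Gordon equation, divided by [eps^2]. *)
Definition residual (eps nu : R) (u w : Z -> R) (j : Z) : R :=
  let g := vf nu u w in
  let h := fun j => - vf nu w u j in
  let u1 := du eps nu u w in
  let w1 := dw eps nu u w in
  let g1 := dvf nu u w u1 w1 in
  let h1 := fun j => - dvf nu w u w1 u1 j in
  let X := approx (eps * nu) u w in
  2 * (/ 2 * nbr h j
       - 3 / 2 * nu * (2 * (u j * g j + w j * h j) * w j
                       + (u j * u j + w j * w j) * h j))
  + nu / 4 * (6 * (u j * (g j * (u1 j - w j))) + 3 * (u j * u j * (g1 j - h j))
              - 3 * (w j * w j * (g1 j - h j))
              - 12 * (w j * (g j * w1 j - w j * h j))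
              - 6 * (u j * (h j * (w1 j + u j))) - 6 * (u j * (w j * (g j + h1 j))))
  + nu * nu / 4 * (cub u w j * (X j * X j + 2 * (u j * X j) + 4 * (u j * u j)))
  - nu / 4 * nbr (cub u w) j.

(** Orders 0 and 1 in [eps] cancel. Since [cos^3 = (3 cos + cos 3)/4], the cubic term splits as
    [(2 u)^3 = 6 |b|^2 u + 2 Re (b^3)]. The resonant part [6 |b|^2 u] and the coupling [nbr (2 u)]
    are balanced by the dNLS equation. To leading order [Re (b^3)] oscillates at frequency 3, so the
    operator [d^2/dt^2 + 1] multiplies it by [1 - 9 = -8]; the coefficient [rho / 4] then produces
    exactly [- 2 rho Re (b^3)]. *)
Lemma approx_residual (eps nu : R) (u w : Z -> R) (j : Z) :
  ddapprox (eps * nu) u w (du eps nu u w) (dw eps nu u w)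
    (ddu eps nu u w) (ddw eps nu u w) j
  + approx (eps * nu) u w j + eps * nu * approx (eps * nu) u w j ^ 3
  - eps * nbr (approx (eps * nu) u w) j
  = eps ^ 2 * residual eps nu u w j.
Proof.
  unfold residual, ddapprox, approx.
  set (u2 := ddu eps nu u w j); set (w2 := ddw eps nu u w j).
  set (g1 := dvf nu u w _ _ j).
  set (h1 := dvf nu w u _ _ j).
  assert (E2 : u2 = - dw eps nu u w j + eps * g1) by reflexivity.
  assert (E2' : w2 = du eps nu u w j - eps * h1) by reflexivity.
  (* Only [g1] has to be expanded, as it enters [2 * u2] at order [eps]; [h1] occurs solely inside
     the third harmonic, with a factor [eps ^ 2], and stays opaque. *)
  assert (E1 : g1 = / 2 * nbr (dw eps nu u w) j
     - 3 / 2 * nu * (2 * (u j * du eps nu u w j + w j * dw eps nu u w j) * w j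
                  + (u j * u j + w j * w j) * dw eps nu u w j)) by reflexivity.
  clearbody u2 w2; subst u2 w2.
  assert (Es : nbr (dw eps nu u w) j
               = nbr u j + eps * nbr (fun k => - vf nu w u k) j)
    by (unfold nbr, dw; ring).
  assert (Ea : nbr (fun k => 2 * u k + eps * nu / 4 * cub u w k) j
               = 2 * nbr u j + eps * nu / 4 * nbr (cub u w) j)
    by (unfold nbr; field).
  rewrite Ea.
  assert (Eu : du eps nu u w j = - w j + eps * vf nu u w j) by reflexivity.
  assert (Ew : dw eps nu u w j = u j - eps * vf nu w u j) by reflexivity.
  rewrite Eu, Ew in *. rewrite Es in E1.
  assert (Eh : vf nu w u j = / 2 * nbr u j
      - 3 / 2 * nu * ((w j * w j + u j * u j) * u j)) by reflexivity.
  set (nh := nbr (fun k => - vf nu w u k) j) in *.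
  set (g := vf nu u w j) in *.
  set (h := vf nu w u j) in *.
  (* Eliminating [nbr u j] in favour of [h] leaves an identity between finitely many free
     scalars. *)
  assert (En : nbr u j = 2 * h + 3 * nu * ((w j * w j + u j * u j) * u j))
    by (rewrite Eh; field).
  rewrite En in *.
  set (nc := nbr (cub u w) j).
  unfold cub.
  clearbody nc nh g h h1 g1.
  set (x := u j) in *; set (y := w j) in *; clearbody x y.
  clear - E1.
  (* [E1] enters linearly: the defect is [2 eps] times its own defect. *)
  apply Rminus_diag_uniq.
  match type of E1 with _ = ?v =>
    transitivity (2 * eps * (g1 - v)); [field|rewrite E1; ring]
  end.
Qed.

Lemma l2_deriv_nbr (x v : R -> Z -> R) :
  l2_deriv x v -> l2_deriv (fun t j => nbr (x t) j) (fun t j => nbr (v t) j).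
Proof.
  intros Hx.
  exact (l2_deriv_plus _ _ _ _ (l2_deriv_next x v Hx) (l2_deriv_prev x v Hx)).
Qed.

(** Evaluating the left factor at the arbitrary point [(0, 0)] detects whether it is constant, which
    decides between the scalar rule and the product rule. The derivative is built as an existential
    variable and compared with the intended formula afterwards. *)
Ltac l2_deriv_tac :=
  lazymatch goal with
  | |- l2_deriv (fun t j => _ + _) _ => apply l2_deriv_plus; l2_deriv_tac
  | |- l2_deriv (fun t j => _ - _) _ => apply l2_deriv_minus; l2_deriv_tac
  | |- l2_deriv (fun t j => nbr _ j) _ => apply l2_deriv_nbr; l2_deriv_tac
  | |- l2_deriv (fun t j => @?c t j * _) _ =>
      let k := eval cbv beta in (c 0 0%Z) in
      tryif constr_eq c (fun (_ : R) (_ : Z) => k)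
      then apply (l2_deriv_scal k); l2_deriv_tac
      else apply l2_deriv_mult; l2_deriv_tac
  | |- _ => eassumption
  end.

Lemma l2_deriv_opp (x v : R -> Z -> R) :
  l2_deriv x v -> l2_deriv (fun t j => - x t j) (fun t j => - v t j).
Proof.
  intros Hx.
  eapply l2_deriv_eq; [eapply l2_deriv_eq_l|].
  - exact (l2_deriv_scal (-1) _ _ Hx).
  - intros; simpl; ring.
  - intros; simpl; ring.
Qed.

Lemma l2_deriv_vf (nu : R) (u w u1 w1 : R -> Z -> R) :
  l2_deriv u u1 -> l2_deriv w w1 ->
  l2_deriv (fun t j => vf nu (u t) (w t) j)
    (fun t j => dvf nu (u t) (w t) (u1 t) (w1 t) j).
Proof.
  intros Hu Hw; unfold vf.
  eapply l2_deriv_eq; [l2_deriv_tac|].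
  intros t j; unfold dvf; simpl; ring.
Qed.

Lemma l2_deriv_du (eps nu : R) (u w : R -> Z -> R) :
  l2_deriv u (fun t j => du eps nu (u t) (w t) j) ->
  l2_deriv w (fun t j => dw eps nu (u t) (w t) j) ->
  l2_deriv (fun t j => du eps nu (u t) (w t) j)
    (fun t j => ddu eps nu (u t) (w t) j).
Proof.
  intros Hu Hw; unfold du at 1.
  apply l2_deriv_plus; [now apply l2_deriv_opp|].
  apply l2_deriv_scal.
  exact (l2_deriv_vf nu _ _ _ _ Hu Hw).
Qed.

Lemma l2_deriv_dw (eps nu : R) (u w : R -> Z -> R) :
  l2_deriv u (fun t j => du eps nu (u t) (w t) j) ->
  l2_deriv w (fun t j => dw eps nu (u t) (w t) j) ->
  l2_deriv (fun t j => dw eps nu (u t) (w t) j)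
    (fun t j => ddw eps nu (u t) (w t) j).
Proof.
  intros Hu Hw; unfold dw at 1.
  apply l2_deriv_minus; [trivial|].
  apply l2_deriv_scal.
  exact (l2_deriv_vf nu _ _ _ _ Hw Hu).
Qed.

Lemma l2_deriv_approx (rho : R) (u w u1 w1 : R -> Z -> R) :
  l2_deriv u u1 -> l2_deriv w w1 ->
  l2_deriv (fun t j => approx rho (u t) (w t) j)
    (fun t j => dapprox rho (u t) (w t) (u1 t) (w1 t) j).
Proof.
  intros Hu Hw; unfold approx, cub.
  eapply l2_deriv_eq; [l2_deriv_tac|].
  intros t j; unfold dapprox; simpl; ring.
Qed.

Lemma l2_deriv_dapprox (rho : R) (u w u1 w1 u2 w2 : R -> Z -> R) :
  l2_deriv u u1 -> l2_deriv w w1 -> l2_deriv u1 u2 -> l2_deriv w1 w2 ->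
  l2_deriv (fun t j => dapprox rho (u t) (w t) (u1 t) (w1 t) j)
    (fun t j => ddapprox rho (u t) (w t) (u1 t) (w1 t) (u2 t) (w2 t) j).
Proof.
  intros Hu Hw Hu1 Hw1; unfold dapprox.
  eapply l2_deriv_eq; [l2_deriv_tac|].
  intros t j; unfold ddapprox; simpl; ring.
Qed.

(** * Uniformly bounded families in l^2(Z) *)

Section Families.

Context {I : Type} (D : I -> Prop).

(** The index will be a pair [(eps, t)], with [D] restricting [eps]. With the bound existential, the
    class is closed under the algebraic operations that build [residual]. *)
Definition unif_l2 (x : I -> Z -> R) : Prop :=
  exists K, forall i, D i -> in_l2 (x i) /\ l2norm (x i) <= K.

Definition unif_R (c : I -> R) : Prop :=
  exists K, forall i, D i -> Rabs (c i) <= K.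

Lemma unif_R_const (c : R) : unif_R (fun _ => c).
Proof. exists (Rabs c); intros; lra. Qed.

Lemma unif_R_mult (c d : I -> R) :
  unif_R c -> unif_R d -> unif_R (fun i => c i * d i).
Proof.
  intros [K HK] [L HL]; exists (K * L); intros i Hi.
  rewrite Rabs_mult; apply Rmult_le_compat; auto using Rabs_pos.
Qed.

Lemma unif_l2_plus (x y : I -> Z -> R) :
  unif_l2 x -> unif_l2 y -> unif_l2 (fun i j => x i j + y i j).
Proof.
  intros [K HK] [L HL]; exists (K + L); intros i Hi.
  destruct (HK i Hi) as [Hx Kx]; destruct (HL i Hi) as [Hy Ky]; split.
  - now apply in_l2_plus.
  - eapply Rle_trans; [now apply l2norm_triangle|lra].
Qed.

Lemma unif_l2_scal (c : I -> R) (x : I -> Z -> R) :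
  unif_R c -> unif_l2 x -> unif_l2 (fun i j => c i * x i j).
Proof.
  intros [K HK] [L HL]; exists (K * L); intros i Hi.
  destruct (HL i Hi) as [Hx Kx]; split.
  - now apply in_l2_scal.
  - rewrite l2norm_scal; apply Rmult_le_compat;
      auto using Rabs_pos, l2norm_ge0.
Qed.

Lemma unif_l2_opp (x : I -> Z -> R) : unif_l2 x -> unif_l2 (fun i j => - x i j).
Proof.
  intros Hx; replace (fun i j => - x i j) with (fun i j => (-1) * x i j)
    by (extensionality i; extensionality j; ring).
  apply (unif_l2_scal (fun _ => -1)); trivial; apply unif_R_const.
Qed.

Lemma unif_l2_minus (x y : I -> Z -> R) :
  unif_l2 x -> unif_l2 y -> unif_l2 (fun i j => x i j - y i j).
Proof.
  intros Hx Hy; apply (unif_l2_plus x (fun i j => - y i j)); trivial.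
  now apply unif_l2_opp.
Qed.

Lemma unif_l2_mult (x y : I -> Z -> R) :
  unif_l2 x -> unif_l2 y -> unif_l2 (fun i j => x i j * y i j).
Proof.
  intros [K HK] [L HL]; exists (K * L); intros i Hi.
  destruct (HK i Hi) as [Hx Kx]; destruct (HL i Hi) as [Hy Ky]; split.
  - now apply in_l2_mult.
  - eapply Rle_trans; [now apply l2norm_mult|].
    apply Rmult_le_compat; auto using l2norm_ge0.
Qed.

Lemma unif_l2_nbr (x : I -> Z -> R) :
  unif_l2 x -> unif_l2 (fun i j => nbr (x i) j).
Proof.
  intros [K HK].
  apply (unif_l2_plus (fun i j => x i (j + 1)%Z) (fun i j => x i (j - 1)%Z));
    exists K; intros i Hi; destruct (HK i Hi) as [Hx Kx].
  - split; [now apply in_l2_next|now rewrite l2norm_next].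
  - split; [now apply in_l2_prev|now rewrite l2norm_prev].
Qed.

Ltac unif_R_tac :=
  repeat first [ assumption | apply unif_R_const | apply unif_R_mult ].

Ltac unif_l2_tac :=
  lazymatch goal with
  | |- unif_l2 (fun i j => _ + _) => apply unif_l2_plus; unif_l2_tac
  | |- unif_l2 (fun i j => _ - _) => apply unif_l2_minus; unif_l2_tac
  | |- unif_l2 (fun i j => - _) => apply unif_l2_opp; unif_l2_tac
  | |- unif_l2 (fun i j => nbr _ j) => apply unif_l2_nbr; unif_l2_tac
  | |- unif_l2 (fun i j => @?c i j * _) =>
      let k := eval cbv beta in (fun i => c i 0%Z) in
      let c' := eval cbv beta in (fun (i : I) (_ : Z) => k i) in
      tryif constr_eq c c'
      then apply (unif_l2_scal k); [unif_R_tac|unif_l2_tac]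
      else apply unif_l2_mult; unif_l2_tac
  | |- _ => assumption
  end.

Lemma unif_l2_residual (eps nu : I -> R) (u w : I -> Z -> R) :
  unif_R eps -> unif_R nu -> unif_l2 u -> unif_l2 w ->
  unif_l2 (fun i j => residual (eps i) (nu i) (u i) (w i) j).
Proof.
  intros He Hn Hu Hw.
  assert (Hvf : forall x y, unif_l2 x -> unif_l2 y ->
            unif_l2 (fun i j => vf (nu i) (x i) (y i) j))
    by (intros; unfold vf, Rdiv; unif_l2_tac).
  assert (Hdvf : forall x y x1 y1,
            unif_l2 x -> unif_l2 y -> unif_l2 x1 -> unif_l2 y1 ->
            unif_l2 (fun i j => dvf (nu i) (x i) (y i) (x1 i) (y1 i) j))
    by (intros; unfold dvf, Rdiv; unif_l2_tac).
  assert (G := Hvf _ _ Hu Hw); assert (H := Hvf _ _ Hw Hu).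
  assert (U1 : unif_l2 (fun i j => du (eps i) (nu i) (u i) (w i) j))
    by (unfold du; unif_l2_tac).
  assert (W1 : unif_l2 (fun i j => dw (eps i) (nu i) (u i) (w i) j))
    by (unfold dw; unif_l2_tac).
  assert (G1 := Hdvf _ _ _ _ Hu Hw U1 W1).
  assert (H1 := Hdvf _ _ _ _ Hw Hu W1 U1).
  assert (C : unif_l2 (fun i j => cub (u i) (w i) j))
    by (unfold cub; unif_l2_tac).
  assert (X : unif_l2 (fun i j => approx (eps i * nu i) (u i) (w i) j))
    by (unfold approx, Rdiv; unif_l2_tac).
  unfold residual, Rdiv; unif_l2_tac.
Qed.

End Families.

(** * From the dNLS equation to the rotating frame *)

Lemma norm_C_sqr (z : C) :
  @norm R_AbsRing C_R_NormedModule z ^ 2 = Re z * Re z + Im z * Im z.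
Proof.
  rewrite norm_C_R; unfold Cmod, Re, Im.
  rewrite <- Rsqr_pow2, Rsqr_sqrt by nra; ring.
Qed.

Lemma in_l2_Re (z : Z -> C) :
  @in_l2 C_R_NormedModule z -> in_l2 (fun j => Re (z j)).
Proof.
  intros Hz; apply in_l2_sqr; revert Hz; apply ex_Zseries_le; intros j.
  rewrite norm_C_sqr, Rabs_pos_eq by apply Rle_0_sqr.
  generalize (Rle_0_sqr (Im (z j))); unfold Rsqr; lra.
Qed.

Lemma in_l2_Im (z : Z -> C) :
  @in_l2 C_R_NormedModule z -> in_l2 (fun j => Im (z j)).
Proof.
  intros Hz; apply in_l2_sqr; revert Hz; apply ex_Zseries_le; intros j.
  rewrite norm_C_sqr, Rabs_pos_eq by apply Rle_0_sqr.
  generalize (Rle_0_sqr (Re (z j))); unfold Rsqr; lra.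
Qed.

Lemma l2norm_C (z : Z -> C) :
  in_l2 (fun j => Re (z j)) -> in_l2 (fun j => Im (z j)) ->
  @l2norm C_R_NormedModule z
  = sqrt (ip (fun j => Re (z j)) (fun j => Re (z j))
          + ip (fun j => Im (z j)) (fun j => Im (z j))).
Proof.
  intros Hr Hi; unfold l2norm, ip.
  rewrite <- Zseries_plus by now apply ex_ip.
  do 2 f_equal; extensionality j; apply norm_C_sqr.
Qed.

Lemma is_derive_l2_deriv (x : R -> Z -> R) (v : R -> Z -> R) :
  (forall t, in_l2 (x t)) -> (forall t, is_derive_l2 x t (v t)) ->
  l2_deriv x v.
Proof.
  intros Hx Hv t; destruct (Hv t) as [Hvt Hlim].
  split; [apply Hx|split; [exact Hvt|exact Hlim]].
Qed.

(** The squared norm of the complex difference quotient is the sum of those of its real and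
    imaginary parts, hence dominates each of them. *)
Lemma is_derive_l2_C (a : R -> Z -> C) (p1 q1 : R -> Z -> R) :
  (forall t, @in_l2 C_R_NormedModule (a t)) ->
  (forall t, exists da, @is_derive_l2 C_R_NormedModule a t da /\
     forall j, Re (da j) = p1 t j /\ Im (da j) = q1 t j) ->
  l2_deriv (fun t j => Re (a t j)) p1 /\ l2_deriv (fun t j => Im (a t j)) q1.
Proof.
  intros Ha Hd.
  assert (Hp := fun t => in_l2_Re _ (Ha t)).
  assert (Hq := fun t => in_l2_Im _ (Ha t)).
  assert (K : forall t, in_l2 (p1 t) /\ in_l2 (q1 t) /\
    is_lim (fun h => sqrt (ip (diff_quot (fun s j => Re (a s j)) p1 t h)
                              (diff_quot (fun s j => Re (a s j)) p1 t h)
                           + ip (diff_quot (fun s j => Im (a s j)) q1 t h)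
                               (diff_quot (fun s j => Im (a s j)) q1 t h)))
      0 0).
  { intros t; destruct (Hd t) as [da [[Hda Hlim] E]].
    assert (Ep : p1 t = fun j => Re (da j))
      by (extensionality j; symmetry; apply E).
    assert (Eq : q1 t = fun j => Im (da j))
      by (extensionality j; symmetry; apply E).
    assert (H1 : in_l2 (p1 t)) by (rewrite Ep; now apply in_l2_Re).
    assert (H2 : in_l2 (q1 t)) by (rewrite Eq; now apply in_l2_Im).
    split; [|split]; trivial.
    revert Hlim; apply is_lim_ext; intros h.
    assert (R1 : diff_quot (fun s j => Re (a s j)) p1 t h
      = fun j => Re (@minus C_R_NormedModule
          (scal (/ h) (minus (a (t + h) j) (a t j))) (da j)))
      by (unfold diff_quot; rewrite Ep; reflexivity).
    assert (R2 : diff_quot (fun s j => Im (a s j)) q1 t h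
      = fun j => Im (@minus C_R_NormedModule
          (scal (/ h) (minus (a (t + h) j) (a t j))) (da j)))
      by (unfold diff_quot; rewrite Eq; reflexivity).
    rewrite R1, R2; apply l2norm_C.
    - rewrite <- R1; now apply (diff_quot_in_l2 (fun s j => Re (a s j))).
    - rewrite <- R2; now apply (diff_quot_in_l2 (fun s j => Im (a s j))). }
  assert (DP : forall t h, in_l2 (diff_quot (fun s j => Re (a s j)) p1 t h))
    by (intros t h; apply diff_quot_in_l2; [exact Hp|exact (proj1 (K t))]).
  assert (DQ : forall t h, in_l2 (diff_quot (fun s j => Im (a s j)) q1 t h))
    by (intros t h; apply diff_quot_in_l2; [exact Hq|exact (proj1 (proj2 (K t)))]).
  split; intros t; destruct (K t) as [K1 [K2 K3]]; split; trivial;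
    split; trivial; (eapply is_lim_squeeze0; [|exact K3]); intros h _;
    (split; [apply l2norm_ge0|]); rewrite l2norm_ip; apply sqrt_le_1_alt.
  - generalize (ip_ge0 _ (DQ t h)); lra.
  - generalize (ip_ge0 _ (DP t h)); lra.
Qed.

Lemma dNLS_deriv (nu : R) (a : R -> Z -> C) :
  dNLS_solution nu a ->
  let p := fun t j => Re (a t j) in
  let q := fun t j => Im (a t j) in
  l2_deriv p (fun t j => vf nu (p t) (q t) j) /\
  l2_deriv q (fun t j => - vf nu (q t) (p t) j).
Proof.
  intros H p q; apply is_derive_l2_C; [intros t; apply H|].
  intros t; destruct (H t) as [_ [da [Hda E]]].
  exists da; split; trivial; intros j; specialize (E j).
  assert (N : Cmod (a t j) ^ 2 = p t j * p t j + q t j * q t j)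
    by (rewrite <- norm_C_R; apply norm_C_sqr).
  rewrite N in E.
  assert (E1 := f_equal Re E); assert (E2 := f_equal Im E).
  unfold vf, nbr, p, q, Re, Im in *.
  destruct (da j) as [d1 d2]; destruct (a t j) as [x y].
  destruct (a t (j + 1)%Z) as [x1 y1]; destruct (a t (j - 1)%Z) as [x2 y2].
  simpl in *; split; lra.
Qed.

Definition rot_re (eps : R) (a : R -> Z -> C) (t : R) (j : Z) : R :=
  cos t * Re (a (eps * t)%R j) + (- sin t) * Im (a (eps * t)%R j).

Definition rot_im (eps : R) (a : R -> Z -> C) (t : R) (j : Z) : R :=
  sin t * Re (a (eps * t)%R j) + cos t * Im (a (eps * t)%R j).

Lemma rot_deriv (eps nu : R) (a : R -> Z -> C) :
  eps <> 0 -> dNLS_solution nu a ->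
  let u := rot_re eps a in let w := rot_im eps a in
  l2_deriv u (fun t j => du eps nu (u t) (w t) j) /\
  l2_deriv w (fun t j => dw eps nu (u t) (w t) j).
Proof.
  intros He H u w.
  destruct (dNLS_deriv nu a H) as [Hp Hq].
  apply (l2_deriv_comp_scal eps) in Hp; trivial.
  apply (l2_deriv_comp_scal eps) in Hq; trivial.
  assert (Dc : forall t, is_derive cos t (- sin t))
    by (intros; auto_derive; trivial; ring).
  assert (Ds : forall t, is_derive sin t (cos t))
    by (intros; auto_derive; trivial; ring).
  assert (Dm : forall t, is_derive (fun t => - sin t) t (- cos t))
    by (intros; auto_derive; trivial; ring).
  (* Gauge covariance: [|a|^2] is invariant under rotation and [nbr] is linear, so the dNLS vector
     field commutes with the rotation by [t]. *)
  assert (V : forall t j,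
    vf nu (u t) (w t) j
    = cos t * vf nu (fun j => Re (a (eps * t) j)) (fun j => Im (a (eps * t) j)) j
      + sin t * vf nu (fun j => Im (a (eps * t) j)) (fun j => Re (a (eps * t) j)) j
    /\ vf nu (w t) (u t) j
    = - sin t * vf nu (fun j => Re (a (eps * t) j)) (fun j => Im (a (eps * t) j)) j
      + cos t * vf nu (fun j => Im (a (eps * t) j)) (fun j => Re (a (eps * t) j)) j).
  { intros t j; unfold vf, nbr, u, w, rot_re, rot_im.
    set (x := Re (a (eps * t) j)); set (y := Im (a (eps * t) j)).
    assert (F : (cos t * x + - sin t * y) * (cos t * x + - sin t * y)
                + (sin t * x + cos t * y) * (sin t * x + cos t * y)
                = x * x + y * y).
    { generalize (sin2_cos2 t); unfold Rsqr; intros T.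
      transitivity ((sin t * sin t + cos t * cos t) * (x * x + y * y));
        [ring|rewrite T; ring]. }
    split.
    - rewrite F; ring.
    - rewrite Rplus_comm in F; rewrite F; ring. }
  split.
  - eapply l2_deriv_eq.
    + apply l2_deriv_plus.
      * exact (l2_deriv_mult_fun _ _ _ _ Dc Hp).
      * exact (l2_deriv_mult_fun _ _ _ _ Dm Hq).
    + intros t j; unfold du; rewrite (proj1 (V t j)).
      unfold w, rot_im; simpl; ring.
  - eapply l2_deriv_eq.
    + apply l2_deriv_plus.
      * exact (l2_deriv_mult_fun _ _ _ _ Ds Hp).
      * exact (l2_deriv_mult_fun _ _ _ _ Dc Hq).
    + intros t j; unfold dw; rewrite (proj2 (V t j)).
      unfold u, rot_re; simpl; ring.
Qed.

Lemma cis_add (s t : R) : (cis s * cis t)%C = cis (s + t).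
Proof.
  unfold cis; rewrite cos_plus, sin_plus; unfold Cmult; simpl.
  f_equal; ring.
Qed.

Lemma leading_order_rot (rho eps : R) (a : R -> Z -> C) :
  leading_order rho eps a
  = fun t j => approx rho (rot_re eps a t) (rot_im eps a t) j.
Proof.
  extensionality t; extensionality j.
  unfold leading_order, leading_orderC, approx, cub, rot_re, rot_im.
  (* Once [cis (3 * t)] is split into powers of [cis t], both sides are the same polynomial in
     [cos t], [sin t] and the parts of [a]. *)
  replace (3 * t) with (t + (t + t)) by ring.
  replace (- (t + (t + t))) with (- t + (- t + - t)) by ring.
  rewrite <- !cis_add; unfold cis; rewrite cos_neg, sin_neg.
  destruct (a (eps * t) j) as [x y].
  simpl; field.
Qed.

(** Summation by parts: the forward and backward shifts are adjoint to each other, so their sum is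
    symmetric. *)
Lemma ip_nbr (x y : Z -> R) :
  in_l2 x -> in_l2 y -> ip x (nbr y) = ip (nbr x) y.
Proof.
  intros Hx Hy.
  change (ip x (fun j => y (j + 1)%Z + y (j - 1)%Z)
          = ip (fun j => x (j + 1)%Z + x (j - 1)%Z) y).
  rewrite ip_plus_r, ip_plus_l; auto using in_l2_next, in_l2_prev.
  rewrite (ip_next_r x y), (ip_comm x (fun j => y (j - 1)%Z)),
    <- (ip_next_r y x), (ip_comm y); trivial; ring.
Qed.

Lemma in_l2_nbr (x : Z -> R) : in_l2 x -> in_l2 (nbr x).
Proof.
  intros Hx; exact (in_l2_plus _ _ (in_l2_next x Hx) (in_l2_prev x Hx)).
Qed.

(** In [u u' + w w'] the rotation and the cubic terms cancel pointwise; the coupling leaves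
    [eps / 2 * (u nbr w - w nbr u)], whose sum vanishes by symmetry of [nbr]. *)
Lemma rot_norm_conserved (eps nu : R) (u w : R -> Z -> R) (t : R) :
  l2_deriv u (fun t j => du eps nu (u t) (w t) j) ->
  l2_deriv w (fun t j => dw eps nu (u t) (w t) j) ->
  ip (u t) (u t) + ip (w t) (w t) = ip (u 0) (u 0) + ip (w 0) (w 0).
Proof.
  intros Hu Hw.
  assert (D : forall s, is_derive (fun s => ip (u s) (u s) + ip (w s) (w s)) s 0).
  { intros s; evar_last.
    - apply (is_derive_plus (fun s => ip (u s) (u s)) (fun s => ip (w s) (w s))).
      + apply (ip_deriv _ _ _ _ s Hu Hu).
      + apply (ip_deriv _ _ _ _ s Hw Hw).
    - unfold plus; simpl.
      rewrite (ip_comm (fun j => du _ _ _ _ j)), (ip_comm (fun j => dw _ _ _ _ j)).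
      assert (U := l2_deriv_in _ _ s Hu); assert (W := l2_deriv_in _ _ s Hw).
      assert (U1 := l2_deriv_in' _ _ s Hu); assert (W1 := l2_deriv_in' _ _ s Hw).
      assert (Z0 : ip (u s) (fun j => du eps nu (u s) (w s) j)
                   + ip (w s) (fun j => dw eps nu (u s) (w s) j) = 0).
      { transitivity (eps / 2 * (ip (u s) (nbr (w s)) + (-1) * ip (w s) (nbr (u s))));
          [|rewrite (ip_nbr (w s)), (ip_comm (nbr (w s))) by trivial; ring].
        rewrite <- ip_scal_r.
        unfold ip.
        rewrite <- !Zseries_plus, <- Zseries_scal.
        - f_equal; extensionality j; unfold du, dw, vf; field.
        - apply ex_ip; trivial; now apply in_l2_nbr.
        - apply (ex_ip (w s) (fun j => -1 * nbr (u s) j)); trivial.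
          now apply in_l2_scal, in_l2_nbr.
        - now apply ex_ip.
        - now apply (ex_ip (w s) (fun j => dw eps nu (u s) (w s) j)). }
      lra. }
  destruct (Req_dec t 0) as [->|Ht]; trivial.
  destruct (MVT_gen (fun s => ip (u s) (u s) + ip (w s) (w s)) 0 t (fun _ => 0))
    as [c [_ Hc]].
  - intros; apply D.
  - intros s _; apply derivable_continuous_pt; exists 0.
    apply is_derive_Reals, D.
  - lra.
Qed.

(** * The energy estimate *)

Definition energy (eps : R) (y y1 : Z -> R) : R :=
  / 2 * ip y1 y1 + / 2 * ip y y - eps * ip y (fun j => y (j + 1)%Z).

(** By Cauchy-Schwarz and shift invariance the coupling is at most [eps * l2norm y ^ 2], whence the
    constants [1/2 - 1/8] and [1/2 + 1/8]. *)
Lemma energy_bounds (eps : R) (y y1 : Z -> R) :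
  0 <= eps <= / 8 -> in_l2 y -> in_l2 y1 ->
  3 / 8 * (l2norm y ^ 2 + l2norm y1 ^ 2) <= energy eps y y1
    <= 5 / 8 * (l2norm y ^ 2 + l2norm y1 ^ 2).
Proof.
  intros He Hy Hy1.
  assert (P := ip_le y _ Hy (in_l2_next y Hy)).
  rewrite l2norm_next in P by trivial; apply Rabs_le_between in P.
  unfold energy; rewrite <- !l2norm_sqr by trivial.
  set (p := ip _ _) in *.
  generalize (Rle_0_sqr (l2norm y)), (Rle_0_sqr (l2norm y1)).
  unfold Rsqr; intros; split; nra.
Qed.

(** The energy counts each bond once; differentiating both of its ends and moving a shift across the
    product yields the two neighbours in [nbr]. The right factor is thus the full linear part of the
    Klein-Gordon operator. *)
Lemma energy_deriv (eps : R) (y y1 y2 : R -> Z -> R) (t : R) :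
  l2_deriv y y1 -> l2_deriv y1 y2 ->
  is_derive (fun s => energy eps (y s) (y1 s)) t
    (ip (y1 t) (fun j => y2 t j + y t j - eps * nbr (y t) j)).
Proof.
  intros Hy Hy1.
  assert (Y := l2_deriv_in _ _ t Hy); assert (Y1 := l2_deriv_in _ _ t Hy1).
  assert (Y2 := l2_deriv_in' _ _ t Hy1).
  evar_last.
  - apply (is_derive_minus
      (fun s => / 2 * ip (y1 s) (y1 s) + / 2 * ip (y s) (y s))
      (fun s => eps * ip (y s) (fun j => y s (j + 1)%Z))).
    + apply (is_derive_plus (fun s => / 2 * ip (y1 s) (y1 s))
               (fun s => / 2 * ip (y s) (y s))).
      * apply (is_derive_scal (fun s => ip (y1 s) (y1 s))).
        exact (ip_deriv _ _ _ _ t Hy1 Hy1).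
      * apply (is_derive_scal (fun s => ip (y s) (y s))).
        exact (ip_deriv _ _ _ _ t Hy Hy).
    + apply (is_derive_scal (fun s => ip (y s) (fun j => y s (j + 1)%Z))).
      exact (ip_deriv _ _ _ _ t Hy (l2_deriv_next _ _ Hy)).
  - unfold minus, plus, opp; simpl.
    rewrite (ip_next_r (y t) (y1 t)) by trivial.
    rewrite (ip_comm (fun j => y t (j - 1)%Z)), (ip_comm (y2 t)),
      (ip_comm (y t) (y1 t)).
    replace (fun j => y2 t j + y t j - eps * nbr (y t) j)
      with (fun j => (y2 t j + y t j)
              + (- eps) * (y t (j + 1)%Z + y t (j - 1)%Z))
      by (extensionality j; unfold nbr; ring).
    rewrite ip_plus_r, ip_plus_r, ip_scal_r, ip_plus_r;
      auto using in_l2_plus, in_l2_next, in_l2_prev.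
    + simpl; field.
    + apply (in_l2_scal (- eps) (fun j => y t (j + 1)%Z + y t (j - 1)%Z)).
      auto using in_l2_plus, in_l2_next, in_l2_prev.
Qed.

Lemma energy_deriv_bound (eps rho M K E : R) (y y1 c r : Z -> R) :
  0 < rho -> 0 < M ->
  in_l2 y -> in_l2 y1 -> in_l2 r -> l2norm r <= K ->
  (forall j, Rabs (c j) <= 7 * M ^ 2) ->
  3 / 8 * (l2norm y ^ 2 + l2norm y1 ^ 2) <= E ->
  Rabs (ip y1 (fun j => - rho * (c j * y j) + - eps ^ 2 * r j))
    <= 12 * M ^ 2 * rho * E + K ^ 2 * eps ^ 4 / (2 * rho * M ^ 2).
Proof.
  intros Hrho HM Hy Hy1 Hr HK Hc HE.
  destruct (l2_mult_bounded _ c y Hc Hy) as [Hcy Ncy].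
  rewrite ip_plus_r, !ip_scal_r; auto using in_l2_scal.
  assert (P1 := ip_le y1 _ Hy1 Hcy); assert (P2 := ip_le y1 r Hy1 Hr).
  eapply Rle_trans; [apply Rabs_triang|].
  rewrite !Rabs_mult, Rabs_Ropp, (Rabs_pos_eq rho), Rabs_Ropp,
    (Rabs_pos_eq (eps ^ 2)) by (lra || apply pow2_ge_0).
  assert (N := l2norm_ge0 y); assert (N1 := l2norm_ge0 y1).
  set (n := l2norm y) in *; set (n1 := l2norm y1) in *.
  set (i1 := Rabs (ip y1 (fun j => c j * y j))) in *.
  set (i2 := Rabs (ip y1 r)) in *.
  assert (HM2 : 0 < M ^ 2) by (apply pow_lt; lra).
  assert (Q1 : i1 <= 7 / 2 * M ^ 2 * (n ^ 2 + n1 ^ 2)).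
  { apply Rle_trans with (n1 * (7 * M ^ 2 * n)).
    - eapply Rle_trans; [exact P1|]; now apply Rmult_le_compat_l.
    - generalize (Rle_0_sqr (n - n1)); unfold Rsqr; nra. }
  assert (Q2 : i2 <= n1 * K).
  { eapply Rle_trans; [exact P2|]; now apply Rmult_le_compat_l. }
  (* AM-GM with weight [rho M^2] *)
  assert (Q3 : eps ^ 2 * (n1 * K)
               <= rho * M ^ 2 / 2 * n1 ^ 2 + K ^ 2 * eps ^ 4 / (2 * rho * M ^ 2)).
  { apply Rminus_le.
    replace (eps ^ 2 * (n1 * K)
             - (rho * M ^ 2 / 2 * n1 ^ 2 + K ^ 2 * eps ^ 4 / (2 * rho * M ^ 2)))
      with (- ((rho * M ^ 2 * n1 - K * eps ^ 2) ^ 2 * / (2 * rho * M ^ 2)))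
      by (field; lra).
    assert (0 <= / (2 * rho * M ^ 2))
      by (left; apply Rinv_0_lt_compat; nra).
    generalize (pow2_ge_0 (rho * M ^ 2 * n1 - K * eps ^ 2)); nra. }
  assert (Q4 : eps ^ 2 * i2 <= eps ^ 2 * (n1 * K))
    by (apply Rmult_le_compat_l; [apply pow2_ge_0|trivial]).
  assert (Q5 : rho * i1 <= rho * (7 / 2 * M ^ 2 * (n ^ 2 + n1 ^ 2)))
    by (apply Rmult_le_compat_l; lra).
  assert (Hrm : 0 < M ^ 2 * rho) by now apply Rmult_lt_0_compat.
  assert (Q6 : M ^ 2 * rho * (3 / 8 * (n ^ 2 + n1 ^ 2)) <= M ^ 2 * rho * E)
    by (apply Rmult_le_compat_l; lra).
  assert (0 <= M ^ 2 * rho * n ^ 2)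
    by (apply Rmult_le_pos; [lra|apply pow2_ge_0]).
  assert (0 <= M ^ 2 * rho * n1 ^ 2)
    by (apply Rmult_le_pos; [lra|apply pow2_ge_0]).
  (* The coefficient of [rho * M ^ 2 * (n ^ 2 + n1 ^ 2)] is at most [7/2 + 1/2 = 4], below the
     [12 * 3/8 = 9/2] available from [E]. *)
  nra.
Qed.

(** * Smallness of the error bound *)

(** Separates the initial size [eps ^ 2 / rho] from the growth factor [rho^(-alpha)] of the norm. *)
Lemma Rpower_error (alpha rho eps : R) :
  0 < rho -> 0 < eps ->
  Rpower rho (- 1 - alpha) * eps ^ 2 = / rho * eps ^ 2 * Rpower rho (- alpha).
Proof.
  intros Hr He.
  replace (- 1 - alpha) with (- (1) + - alpha) by ring.
  rewrite Rpower_plus, Rpower_Ropp, Rpower_1 by trivial; ring.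
Qed.

(** The quantity is the power [1 + alpha] of the ratio [eps^(2/(1+alpha)) / rho] that tends to 0;
    hence the threshold [eta^(1/(1+alpha))] for that ratio. *)
Lemma error_small (alpha : R) (rho : R -> R) (eta : R) :
  0 < alpha ->
  (forall eps, 0 < eps <= 1 -> 0 < rho eps <= eps) ->
  filterlim (fun eps => Rpower eps (2 / (1 + alpha)) / rho eps)
    (at_right 0) (locally 0) ->
  0 < eta ->
  exists e0, 0 < e0 /\ forall eps, 0 < eps < e0 -> eps <= 1 ->
    Rpower (rho eps) (- 1 - alpha) * eps ^ 2 < eta.
Proof.
  intros Ha Hrho Hlim Heta.
  destruct (Hlim (fun z => z < Rpower eta (/ (1 + alpha)))) as [d Hd].
  { exists (mkposreal _ (exp_pos _ : 0 < Rpower eta (/ (1 + alpha)))).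
    intros z Hz; apply Rabs_lt_between' in Hz; simpl in Hz; lra. }
  exists d; split; [apply cond_pos|]; intros eps He He1.
  destruct (Hrho eps) as [Hr _]; [lra|].
  assert (Hz : Rpower eps (2 / (1 + alpha)) / rho eps
               < Rpower eta (/ (1 + alpha))).
  { apply Hd; [|lra].
    change (Rabs (eps - 0) < d); rewrite Rminus_0_r, Rabs_pos_eq; lra. }
  assert (Hz0 : 0 < Rpower eps (2 / (1 + alpha)) / rho eps)
    by (apply Rdiv_lt_0_compat; [apply exp_pos|trivial]).
  assert (Hp : Rpower (Rpower eps (2 / (1 + alpha)) / rho eps) (1 + alpha)
               < Rpower (Rpower eta (/ (1 + alpha))) (1 + alpha))
    by (apply Rlt_Rpower_l; [lra|now split]).
  rewrite Rpower_mult, Rinv_l, Rpower_1 in Hp by lra.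
  eapply Rle_lt_trans; [|exact Hp]; right.
  replace (Rpower eps (2 / (1 + alpha)) / rho eps)
    with (Rpower eps (2 / (1 + alpha)) * Rpower (rho eps) (- (1)))
    by (rewrite Rpower_Ropp, Rpower_1 by trivial; reflexivity).
  rewrite <- Rpower_mult_distr, !Rpower_mult by apply exp_pos.
  replace (2 / (1 + alpha) * (1 + alpha)) with (INR 2) by (simpl; field; lra).
  rewrite Rpower_pow by lra.
  replace (- (1) * (1 + alpha)) with (- 1 - alpha) by ring; ring.
Qed.

(** The condition on [k0] at [C_Q = 1]: the other two terms are nonnegative, and one point of the
    neighbourhood suffices. *)
Lemma k0_lower_bound (alpha C_X k0 : R) (rho : R -> R) :
  0 < C_X ->
  at_right 0 (fun eps =>
    6 * C_X ^ 2
    + 12 * C_X * 1 * Rpower (rho eps) (- 1 - alpha) * eps ^ 2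
    + 8 * 1 ^ 2 * Rpower (rho eps) (- (2 * (1 + alpha))) * eps ^ 4 <= k0) ->
  6 * C_X ^ 2 <= k0.
Proof.
  intros HC [d Hd].
  assert (Hp := cond_pos d).
  specialize (Hd (d / 2)).
  eapply Rle_trans; [|apply Hd; [|lra]].
  - assert (0 <= 12 * C_X * 1 * Rpower (rho (d / 2)) (- 1 - alpha) * (d / 2) ^ 2).
    { apply Rmult_le_pos; [|apply pow2_ge_0].
      apply Rmult_le_pos; [lra|left; apply exp_pos]. }
    assert (0 <= 8 * 1 ^ 2 * Rpower (rho (d / 2)) (- (2 * (1 + alpha))) * (d / 2) ^ 4).
    { apply Rmult_le_pos; [|apply pow_le; lra].
      apply Rmult_le_pos; [lra|left; apply exp_pos]. }
    lra.
  - change (Rabs (d / 2 - 0) < d); rewrite Rminus_0_r, Rabs_pos_eq; lra.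
Qed.

(** * Error estimate and choice of the constants *)

Lemma dKG_deriv (rho eps : R) (xi : R -> Z -> R) :
  dKG_solution rho eps xi ->
  l2_deriv xi (dot xi) /\ l2_deriv (dot xi) (dot (dot xi)).
Proof.
  intros H; split; apply is_derive_l2_deriv; intros t; apply (H t).
Qed.

(* Uniform in [eps], since [||u||^2 + ||w||^2] is conserved and [a 0 = a0]. *)
Lemma residual_bound (rho : R -> R) (a0 : Z -> C) (a : R -> R -> Z -> C) :
  (forall eps, 0 < eps <= 1 -> 0 < rho eps <= eps) ->
  (forall eps, 0 < eps <= 1 ->
     dNLS_solution (rho eps / eps) (a eps) /\ forall j, a eps 0 j = a0 j) ->
  exists K, forall eps t, 0 < eps <= 1 ->
    let r := residual eps (rho eps / eps) (rot_re eps (a eps) t)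
               (rot_im eps (a eps) t) in
    in_l2 r /\ l2norm r <= K.
Proof.
  intros Hrho Ha.
  set (D := fun i : R * R => 0 < fst i <= 1).
  set (u := fun i : R * R => rot_re (fst i) (a (fst i)) (snd i)).
  set (w := fun i : R * R => rot_im (fst i) (a (fst i)) (snd i)).
  assert (B : forall i, D i -> in_l2 (u i) /\ in_l2 (w i) /\
    ip (u i) (u i) + ip (w i) (w i)
    = ip (fun j => Re (a0 j)) (fun j => Re (a0 j))
      + ip (fun j => Im (a0 j)) (fun j => Im (a0 j))).
  { intros [eps t] Hi; unfold D, u, w in *; simpl in *.
    destruct (Ha eps Hi) as [Hs H0].
    destruct (rot_deriv eps (rho eps / eps) (a eps)) as [Hu Hw];
      [lra|exact Hs|].
    split; [exact (l2_deriv_in _ _ t Hu)|].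
    split; [exact (l2_deriv_in _ _ t Hw)|].
    rewrite (rot_norm_conserved _ _ _ _ t Hu Hw).
    assert (R0 : rot_re eps (a eps) 0 = fun j => Re (a0 j)).
    { extensionality j; unfold rot_re.
      rewrite Rmult_0_r, H0, cos_0, sin_0; ring. }
    assert (I0 : rot_im eps (a eps) 0 = fun j => Im (a0 j)).
    { extensionality j; unfold rot_im.
      rewrite Rmult_0_r, H0, cos_0, sin_0; ring. }
    now rewrite R0, I0. }
  set (M := ip (fun j => Re (a0 j)) (fun j => Re (a0 j))
            + ip (fun j => Im (a0 j)) (fun j => Im (a0 j))) in *.
  destruct (unif_l2_residual D (fun i => fst i)
              (fun i => rho (fst i) / fst i) u w) as [K HK].
  - exists 1; intros [eps t] Hi; unfold D in Hi; simpl in *.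
    rewrite Rabs_pos_eq; lra.
  (* The assumption [rho <= eps] enters here as [nu <= 1]. *)
  - exists 1; intros [eps t] Hi; unfold D in Hi; simpl in *.
    specialize (Hrho eps Hi).
    rewrite Rabs_pos_eq.
    + apply Rle_div_l; lra.
    + apply Rdiv_le_0_compat; lra.
  - exists (sqrt M); intros i Hi; destruct (B i Hi) as [Bu [Bw E]].
    split; trivial; rewrite l2norm_ip; apply sqrt_le_1_alt.
    generalize (ip_ge0 _ Bw); lra.
  - exists (sqrt M); intros i Hi; destruct (B i Hi) as [Bu [Bw E]].
    split; trivial; rewrite l2norm_ip; apply sqrt_le_1_alt.
    generalize (ip_ge0 _ Bu); lra.
  - exists K; intros eps t He; exact (HK (eps, t) He).
Qed.

(* The rate [12 M^2 rho] for the quadratic energy is twice the rate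
   [6 C_X^2 rho <= k0 rho] available for the norm. *)
Lemma error_estimate (eps rho M K T : R) (xi : R -> Z -> R) (u w : R -> Z -> R) :
  let nu := rho / eps in
  let X := fun t j => approx rho (u t) (w t) j in
  0 < eps <= / 8 -> 0 < rho -> 0 < M ->
  dKG_solution rho eps xi ->
  l2_deriv u (fun t j => du eps nu (u t) (w t) j) ->
  l2_deriv w (fun t j => dw eps nu (u t) (w t) j) ->
  (forall t, in_l2 (residual eps nu (u t) (w t)) /\
             l2norm (residual eps nu (u t) (w t)) <= K) ->
  (forall t, l2norm (X t) <= M) ->
  let F := (5 / 8 * l2_dist1 xi X 0 ^ 2
            + K ^ 2 / (24 * M ^ 4) * (/ rho * eps ^ 2) ^ 2)
           * exp (12 * M ^ 2 * rho * T) in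
  F < 3 / 8 * M ^ 2 ->
  forall t, - T <= t <= T -> l2_dist1 xi X t ^ 2 <= 16 / 3 * F.
Proof.
  intros nu X He Hrho HM Hxi Hu Hw HR HX F HF.
  destruct (dKG_deriv _ _ _ Hxi) as [Dxi Dxi1].
  assert (Hu1 := l2_deriv_du _ _ _ _ Hu Hw).
  assert (Hw1 := l2_deriv_dw _ _ _ _ Hu Hw).
  assert (DX := l2_deriv_approx rho _ _ _ _ Hu Hw).
  assert (DX1 := l2_deriv_dapprox rho _ _ _ _ _ _ Hu Hw Hu1 Hw1).
  set (X1 := fun t j => dapprox rho _ _ _ _ j) in DX, DX1.
  set (X2 := fun t j => ddapprox rho _ _ _ _ _ _ j) in DX1.
  fold X in DX.
  assert (Dy := l2_deriv_minus _ _ _ _ Dxi DX).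
  assert (Dy1 := l2_deriv_minus _ _ _ _ Dxi1 DX1).
  set (y := fun t j => xi t j - X t j) in *.
  set (y1 := fun t j => dot xi t j - X1 t j) in *.
  set (y2 := fun t j => dot (dot xi) t j - X2 t j) in *.
  assert (Hdist : forall t, l2_dist1 xi X t = l2norm (y t) + l2norm (y1 t))
    by (intros t; unfold l2_dist1; now rewrite (l2_deriv_dot _ _ DX)).
  (* From [(X + y)^3 - X^3 = c * y]. *)
  set (c := fun t j => 3 * X t j ^ 2 + 3 * X t j * y t j + y t j ^ 2).
  assert (Heq : forall t j, y2 t j + y t j - eps * nbr (y t) j
    = - rho * (c t j * y t j) + - eps ^ 2 * residual eps nu (u t) (w t) j).
  { intros t j.
    assert (E1 := approx_residual eps nu (u t) (w t) j).
    replace (eps * nu) with rho in E1 by (unfold nu; field; lra).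
    destruct (Hxi t) as [_ [_ [_ E2]]]; specialize (E2 j).
    change (X2 t j + X t j + rho * X t j ^ 3 - eps * nbr (X t) j
            = eps ^ 2 * residual eps nu (u t) (w t) j) in E1.
    unfold nbr in E1; unfold c, y2, y, nbr; clearbody X2 X.
    set (r := residual _ _ _ _ _) in *; clearbody r; lra. }
  assert (Y := fun t => l2_deriv_in _ _ t Dy).
  assert (Y1 := fun t => l2_deriv_in _ _ t Dy1).
  assert (XI := fun t => l2_deriv_in _ _ t DX).
  assert (HM2 : 0 < M ^ 2) by (apply pow_lt; lra).
  assert (EB := fun t => energy_bounds eps (y t) (y1 t)
                  (conj (Rlt_le _ _ (proj1 He)) (proj2 He)) (Y t) (Y1 t)).
  set (E := fun t => energy eps (y t) (y1 t)) in *.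
  set (B := K ^ 2 * eps ^ 4 / (2 * rho * M ^ 2)).
  assert (Hlam : 0 < 12 * M ^ 2 * rho) by nra.
  (* Dividing the forcing, of order [eps^4 / rho], by the rate brings it to [(eps^2 / rho)^2], the
     order of the initial energy. *)
  assert (HFE : (E 0 + B / (12 * M ^ 2 * rho)) * exp (12 * M ^ 2 * rho * T) <= F).
  { apply Rmult_le_compat_r; [left; apply exp_pos|].
    replace (B / (12 * M ^ 2 * rho))
      with (K ^ 2 / (24 * M ^ 4) * (/ rho * eps ^ 2) ^ 2)
      by (unfold B; field; lra).
    apply Rplus_le_compat_r.
    eapply Rle_trans; [apply EB|]; rewrite Hdist.
    generalize (l2norm_ge0 (y 0)), (l2norm_ge0 (y1 0)); nra. }
  assert (G := gronwall_bootstrap_two_sided E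
    (fun t => ip (y1 t) (fun j => y2 t j + y t j - eps * nbr (y t) j))
    (12 * M ^ 2 * rho) B (3 / 8 * M ^ 2) T).
  intros t Ht.
  assert (Et : E t <= F).
  { eapply Rle_trans; [|exact HFE]; apply G; trivial.
    - unfold B; apply Rmult_le_pos.
      + apply Rmult_le_pos; [apply pow2_ge_0|apply pow_le; lra].
      + left; apply Rinv_0_lt_compat; nra.
    - intros s; now apply energy_deriv.
    - eapply Rle_trans; [|apply EB].
      generalize (pow2_ge_0 (l2norm (y 0))), (pow2_ge_0 (l2norm (y1 0))); lra.
    - intros s Hs.
      replace (fun j => y2 s j + y s j - eps * nbr (y s) j)
        with (fun j => - rho * (c s j * y s j)
                       + - eps ^ 2 * residual eps nu (u s) (w s) j)
        by (extensionality j; now rewrite Heq).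
      apply energy_deriv_bound; trivial; try apply HR; [|apply EB].
      intros j.
      (* The bootstrap level [3 / 8 * M ^ 2] is chosen so that coercivity gives this bound. *)
      assert (Ny : l2norm (y s) <= M).
      { generalize (proj1 (EB s)), (pow2_ge_0 (l2norm (y1 s))).
        change (energy eps (y s) (y1 s)) with (E s); intros.
        apply Rsqr_incr_0; [unfold Rsqr|apply l2norm_ge0|]; lra. }
      assert (Hy := Rle_trans _ _ _ (l2norm_term_le _ j (Y s)) Ny).
      assert (HXj := Rle_trans _ _ _ (l2norm_term_le _ j (XI s)) (HX s)).
      apply Rabs_le_between in Hy; apply Rabs_le_between in HXj.
      (* With [|X|] and [|y|] at most [M], the three terms contribute [3 + 3 + 1 = 7]. *)
      unfold c; apply Rabs_le; split; nra.
    - lra. }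
  rewrite Hdist.
  (* [(n + n1)^2 <= 2 (n^2 + n1^2)], and coercivity contributes [8/3]: together [16/3]. *)
  generalize (proj1 (EB t)), (Rle_0_sqr (l2norm (y t) - l2norm (y1 t))).
  change (energy eps (y t) (y1 t)) with (E t).
  unfold Rsqr; intros; nra.
Qed.

Theorem theorem2 :
  forall (alpha : R) (rho : R -> R) (a0 : Z -> C) (a : R -> R -> Z -> C)
    (C_X k0 : R),
  0 < alpha < 1 ->
  (forall eps, 0 < eps <= 1 -> 0 < rho eps <= eps) ->
  filterlim (fun eps => Rpower eps (2 / (1 + alpha)) / rho eps)
    (at_right 0) (locally 0) ->
  @in_l2 C_R_NormedModule a0 ->
  (forall eps, 0 < eps <= 1 ->
     dNLS_solution (rho eps / eps) (a eps) /\ forall j, a eps 0 j = a0 j) ->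
  0 < C_X ->
  (forall eps t, 0 < eps <= 1 ->
     l2norm (leading_order (rho eps) eps (a eps) t)
     + l2norm (dot (leading_order (rho eps) eps (a eps)) t) <= C_X) ->
  0 < k0 ->
  (forall C_Q, 0 < C_Q ->
     at_right 0 (fun eps =>
       6 * C_X ^ 2
       + 12 * C_X * C_Q * Rpower (rho eps) (- 1 - alpha) * eps ^ 2
       + 8 * C_Q ^ 2 * Rpower (rho eps) (- (2 * (1 + alpha))) * eps ^ 4
       <= k0)) ->
  forall A : R, 0 < A < / k0 * alpha ->
  exists eps0 C_0 C : R,
    0 < eps0 <= 1 /\ 0 < C_0 /\ 0 < C /\
    forall eps, 0 < eps < eps0 ->
    forall xi : R -> Z -> R,
      dKG_solution (rho eps) eps xi ->
      l2_dist1 xi (leading_order (rho eps) eps (a eps)) 0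
        <= C_0 * / rho eps * eps ^ 2 ->
      forall t : R,
        - (A * Rabs (ln (rho eps)) * / rho eps) <= t
          <= A * Rabs (ln (rho eps)) * / rho eps ->
        l2_dist1 xi (leading_order (rho eps) eps (a eps)) t
          <= C * Rpower (rho eps) (- 1 - alpha) * eps ^ 2.
Proof.
  intros alpha rho a0 a C_X k0 Halpha Hrho Hlim _ Ha HCX HX Hk0 HQ A HA.
  assert (Hk : 6 * C_X ^ 2 <= k0) by exact (k0_lower_bound _ _ _ _ HCX (HQ 1 Rlt_0_1)).
  (* Here [A < alpha / k0] meets [6 * C_X ^ 2 <= k0]. *)
  assert (HAk : 12 * C_X ^ 2 * A <= 2 * alpha).
  { assert (k0 * A < k0 * (/ k0 * alpha)) by (apply Rmult_lt_compat_l; lra).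
    replace (k0 * (/ k0 * alpha)) with alpha in * by (field; lra).
    assert (6 * C_X ^ 2 * A <= k0 * A) by (apply Rmult_le_compat_r; lra).
    lra. }
  destruct (residual_bound rho a0 a Hrho Ha) as [K HK].
  set (L := 1 + K ^ 2 / (24 * C_X ^ 4)).
  assert (HL : 0 <= K ^ 2 / (24 * C_X ^ 4)).
  { apply Rmult_le_pos; [apply pow2_ge_0|].
    left; apply Rinv_0_lt_compat; generalize (pow_lt C_X 4 HCX); lra. }
  assert (HCX2 := pow_lt C_X 2 HCX).
  (* The bound 1 gives [(q * P)^2 <= q * P]; the other bound then puts [L * (q * P)^2] below the
     bootstrap level. *)
  set (eta := Rmin 1 (3 / 8 * C_X ^ 2 / L)).
  assert (Heta : 0 < eta).
  { apply Rmin_glb_lt; [lra|apply Rdiv_lt_0_compat; unfold L; lra]. }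
  destruct (error_small alpha rho eta) as [e0 [He0 Hsmall]]; trivial; [lra|].
  (* [/ 8] is for coercivity of the energy. With [C_0 = 1] the initial energy fits into the summand
     1 of [L], and [C = 3 * L] works because [16/3 * L <= 9 * L^2] for [L >= 1]. *)
  exists (Rmin (/ 8) e0), 1, (3 * L).
  assert (H8 := Rmin_l (/ 8) e0); assert (H0 := Rmin_r (/ 8) e0).
  split; [split; [apply Rmin_glb_lt|]; lra|].
  split; [lra|split; [unfold L; lra|]].
  intros eps He xi Hxi Hini t Ht.
  assert (He1 : 0 < eps <= 1) by lra.
  specialize (Hsmall eps ltac:(lra) ltac:(lra)).
  destruct (Hrho eps He1) as [Hr0 Hr1].
  rewrite Rmult_assoc; rewrite Rpower_error in * by lra.
  set (q := / rho eps * eps ^ 2) in *.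
  set (P := Rpower (rho eps) (- alpha)) in *.
  assert (Hq : 0 < q)
    by (apply Rmult_lt_0_compat;
        [now apply Rinv_0_lt_compat|apply pow_lt; lra]).
  assert (HP : 0 < P) by apply exp_pos.
  assert (HqP := Rmult_lt_0_compat _ _ Hq HP).
  set (T := A * Rabs (ln (rho eps)) * / rho eps) in *.
  (* The factor [rho] of the rate cancels against the time scale, leaving [rho^(-12 C_X^2 A)]; since
     [rho < 1], this is at most [rho^(-2 alpha)]. *)
  assert (Hexp : exp (12 * C_X ^ 2 * rho eps * T) <= P ^ 2).
  { assert (Hln : ln (rho eps) < 0) by (rewrite <- ln_1; apply ln_increasing; lra).
    replace (P ^ 2) with (exp (2 * alpha * - ln (rho eps))).
    - replace (12 * C_X ^ 2 * rho eps * T)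
        with (12 * C_X ^ 2 * A * - ln (rho eps))
        by (unfold T; rewrite Rabs_left by lra; field; lra).
      assert (Hle : 12 * C_X ^ 2 * A * - ln (rho eps)
                    <= 2 * alpha * - ln (rho eps))
        by (apply Rmult_le_compat_r; lra).
      destruct Hle as [Hlt| ->]; [left; now apply exp_increasing|lra].
    - unfold P, Rpower; simpl; rewrite Rmult_1_r, <- exp_plus; f_equal; ring. }
  destruct (Ha eps He1) as [Hs _].
  destruct (rot_deriv eps (rho eps / eps) (a eps)) as [Hu Hw]; [lra|exact Hs|].
  rewrite leading_order_rot in *.
  set (X := fun t j => approx _ _ _ j) in *.
  set (F := (5 / 8 * l2_dist1 xi X 0 ^ 2 + K ^ 2 / (24 * C_X ^ 4) * q ^ 2)
            * exp (12 * C_X ^ 2 * rho eps * T)).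
  assert (Hd0 : 0 <= l2_dist1 xi X 0)
    by (apply Rplus_le_le_0_compat; apply l2norm_ge0).
  assert (HF : F <= L * (q * P) ^ 2).
  { replace (L * (q * P) ^ 2) with (L * q ^ 2 * P ^ 2) by ring.
    apply Rmult_le_compat; [|left; apply exp_pos| |trivial].
    - apply Rplus_le_le_0_compat; apply Rmult_le_pos;
        try apply pow2_ge_0; lra.
    - unfold L.
      assert (l2_dist1 xi X 0 ^ 2 <= q ^ 2) by (apply pow_incr; split; [trivial|unfold q; lra]).
      generalize (pow2_ge_0 q); nra. }
  assert (HF' : F < 3 / 8 * C_X ^ 2).
  { eapply Rle_lt_trans; [exact HF|].
    assert (H1 := Rlt_le_trans _ _ _ Hsmall (Rmin_l _ _)).
    assert (H2 := Rlt_le_trans _ _ _ Hsmall (Rmin_r _ _)).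
    apply Rlt_div_r in H2; [|unfold L; lra].
    apply Rle_lt_trans with (q * P * L); [|exact H2].
    assert (0 < q * P * L) by (apply Rmult_lt_0_compat; unfold L; lra).
    clearbody L; nra. }
  assert (HE : l2_dist1 xi X t ^ 2 <= 16 / 3 * F).
  { apply (error_estimate eps (rho eps) C_X K T xi _ _); trivial; [lra| |].
    - intros s; exact (HK eps s He1).
    - intros s; specialize (HX eps s He1); rewrite leading_order_rot in HX.
      generalize (l2norm_ge0 (dot X s)).
      change (l2norm (X s) + l2norm (dot X s) <= C_X) in HX.
      change (0 <= l2norm (dot X s) -> l2norm (X s) <= C_X); lra. }
  apply Rsqr_incr_0_var; [|apply Rmult_le_pos; unfold L; lra].
  unfold Rsqr.
  assert (L * (q * P) ^ 2 <= L * L * (q * P) ^ 2).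
  { apply Rmult_le_compat_r; [apply pow2_ge_0|unfold L; nra]. }
  nra.
Qed.
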